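(* There exists a positive integer $K$ such that if a graph $G$ satisfies the following conditions: (i) $d(x)>K$ holds for all $x\in V(G)$; (ii) for all $x\in V(G)$, any $5$-plex of $G$ containing $x$ has order at most $d(x)-K$; (iii) $\lambda_{\min}(G)\ge -3$; then $G$ is the slim graph of a $2$-fat $\{\mathfrak{f}_1,\mathfrak{f}_2,\mathfrak{f}_3\}$-line Hoffman graph.
   Context: All graphs are finite, undirected and simple. $d(x)$ is the degree of $x$ in $G$, and $\lambda_{\min}(G)$ is the smallest eigenvalue of the adjacency matrix of $G$. For a positive integer $p$, a $p$-plex of $G$ is an induced subgraph in which each vertex is adjacent to all but at most $p-1$ of the other vertices of that subgraph; its order is its number of vertices. A Hoffman graph $\mathfrak{h}$ is a pair $(H,\ell)$ where $H=(V,E)$ is a graph and $\ell:V\to\{\text{fat},\text{slim}\}$ is a labeling such that no two fat vertices are adjacent and every fat vertex has at least one slim neighbor. The slim graph of $\mathfrak{h}$ is the subgraph of $H$ induced on the slim vertices (an ordinary graph). $\mathfrak{h}$ is $t$-fat if every slim vertex has at least $t$ fat neighbors. An induced Hoffman subgraph of $\mathfrak{h}$ is a Hoffman graph $(H_1,\ell_1)$ with $H_1$ an induced subgraph of $H$ and $\ell_1$ the restriction of $\ell$. For a set $W$ of slim vertices, the induced Hoffman subgraph generated by $W$ is the one induced on $W$ together with all fat vertices having a neighbor in $W$. Isomorphisms of Hoffman graphs are graph isomorphisms preserving labels. The special matrix $S(\mathfrak{h})$ is indexed by slim vertices: $S(\mathfrak{h})=A_{\rm slim}-CC^T$, where $A_{\rm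 slim}$ is the adjacency matrix of the slim graph and $C$ is the slim-by-fat $0/1$ adjacency block. A family $\{\mathfrak{h}^i\}_{i=1}^r$ is a decomposition of $\mathfrak{h}$, written $\mathfrak{h}=\uplus_{i=1}^r\mathfrak{h}^i$, if there is a partition of the slim vertex set of $\mathfrak{h}$ into $r$ parts such that $\mathfrak{h}^i$ is the induced Hoffman subgraph generated by the $i$-th part and $S(\mathfrak{h})$ is block diagonal with blocks $S(\mathfrak{h}^1),\dots,S(\mathfrak{h}^r)$ with respect to this partition. For a family $\mathfrak{H}$ of pairwise non-isomorphic Hoffman graphs, a Hoffman graph $\mathfrak{h}$ is an $\mathfrak{H}$-line Hoffman graph if there is a Hoffman graph $\mathfrak{h}'$ such that $\mathfrak{h}'$ has $\mathfrak{h}$ as an induced Hoffman subgraph, $\mathfrak{h}'$ has the same slim graph as $\mathfrak{h}$, and $\mathfrak{h}'=\uplus_{i=1}^r\mathfrak{h}'_i$ where each $\mathfrak{h}'_i$ is isomorphic to an induced Hoffman subgraph of some member of $\mathfrak{H}$. The Hoffman graphs $\mathfrak{f}_1,\mathfrak{f}_2,\mathfrak{f}_3$: - $\mathfrak{f}_1$ has one slim vertex adjacent to three fat vertices. - $\mathfrak{f}_2$ has four slim vertices $x_1,x_2,y_1,y_2$ and four fat vertices $F_{ij}$ ($i,j\in\{1,2\}$); the slim-slim edges are exactly $x_1x_2$ and $y_1y_2$; $x_i$ is adjacent to exactly the fat vertices $F_{i1},F_{i2}$ and $y_j$ to exactly $F_{1j},F_{2j}$. - $\mathfrak{f}_3$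 has two adjacent slim vertices and two fat vertices, each slim vertex being adjacent to both fat vertices. *)

(* Defs.v *)
From HB Require Import structures.
From mathcomp Require Import all_boot all_order all_algebra.
From mathcomp Require Import boolp classical_sets reals.
From mathcomp Require complex spectral.

Set Implicit Arguments.
Unset Strict Implicit.
Unset Printing Implicit Defensive.

Import Order.TTheory GRing.Theory Num.Theory.
Local Open Scope ring_scope.

Record sgraph := SGraph {
  vertex :> finType;
  adj : rel vertex;
  adj_sym : symmetric adj;
  adj_irr : irreflexive adj }.

Section Graphs.
Variable G : sgraph.

Definition deg (x : G) : nat := #|[set y | adj x y]|.

Definition adjmx (R : pzRingType) : 'M[R]_#|G| :=
  \matrix_(i, j) (adj (enum_val i) (enum_val j))%:R.

(* This infimum is a minimum when G has a vertex (lambda_minP below), and is 0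
   for the graph with no vertex. *)
Definition lambda_min (R : realType) : R :=
  inf [set a : R | eigenvalue (adjmx R) a]%classic.

Section LambdaMin.
Import complex spectral ComplexField.
Local Open Scope complex_scope.
Variable R : realType.
Hypothesis G_gt0 : (0 < #|G|)%N.

Lemma adjmx_eigenvalue_ex : exists a : R, eigenvalue (adjmx R) a.
Proof.
pose A := adjmx R; pose f : R -> R[i] := real_complex R.
have [a] := eigenvalue_closed (map_mx f A) G_gt0.
have AT : (map_mx f A)^T = map_mx f A.
  by apply/matrixP=> i j; rewrite !mxE adj_sym.
have AC : map_mx Num.conj (map_mx f A) = map_mx f A.
  by apply/matrixP=> i j; rewrite !mxE /f; case: adj; rewrite ?rmorph1 ?rmorph0.
move=> ea; case/eigenvalueP: (ea) => v vA v0.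
pose w := (map_mx Num.conj v)^T.
have Aw : map_mx f A *m w = Num.conj a *: w.
  rewrite -{1}AT /w -trmx_mul -{1}AC -map_mxM vA.
  by apply/matrixP=> i j; rewrite !mxE rmorphM.
have vw0 : (v *m w) 0 0 != 0.
  apply: contra v0; rewrite mxE => /eqP vw; apply/eqP/rowP=> j; rewrite mxE.
  have ge0 k : k \in index_enum _ -> 0 <= v 0 k * w k 0.
    by rewrite !mxE mul_conjC_ge0.
  have /eqP := vw; rewrite psumr_eq0; last by move=> k _; rewrite ge0 ?mem_index_enum.
  move=> /allP/(_ j); rewrite mem_index_enum !mxE => /(_ isT) /=.
  by rewrite mul_conjC_eq0 => /eqP.
have ra : Num.conj a = a.
  apply: (mulIf vw0).
  have := mulmxA v (map_mx f A) w.
  rewrite Aw vA -scalemxAr -scalemxAl => /matrixP/(_ 0 0).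
  by rewrite [LHS]mxE [RHS]mxE.
have af : a = f (complex.Re a).
  have : a \is Num.real by apply/CrealP.
  by move/RRe_real.
by exists (complex.Re a); move: ea; rewrite af eigenvalue_map.
Qed.

Lemma lambda_minP : eigenvalue (adjmx R) (lambda_min R) /\
  forall a : R, eigenvalue (adjmx R) a -> lambda_min R <= a.
Proof.
have [m em lem] : exists2 m : R, eigenvalue (adjmx R) m &
    forall a, eigenvalue (adjmx R) a -> m <= a.
  have [a0 e0] := adjmx_eigenvalue_ex.
  have p0 : char_poly (adjmx R) != 0 by rewrite monic_neq0 // char_poly_monic.
  have [rs rsP] : exists rs : seq R, forall a, eigenvalue (adjmx R) a -> a \in rs.
    apply: contrapT => /forallNP H.
    have {}H n : exists rs : seq R, [/\ uniq rs, size rs = n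
        & all (root (char_poly (adjmx R))) rs].
      elim: n => [|n [rs [u sz al]]]; first by exists [::].
      have /existsNP[a /not_implyP[ea /negP nin]] := H rs.
      by exists (a :: rs); split; rewrite /= ?nin ?sz // -eigenvalue_root_char ea.
    have [rs [u sz al]] := H (size (char_poly (adjmx R))).
    by have := max_poly_roots p0 al u; rewrite sz ltnn.
  pose es := [seq a <- rs | eigenvalue (adjmx R) a].
  have esP a : (a \in es) = eigenvalue (adjmx R) a.
    rewrite mem_filter; case e: eigenvalue => //=; exact: rsP.
  have := sort_sorted (@le_total _ R) es; have := mem_sort <=%R es.
  case: (sort _ _) => [|m s] ms so.
    by move: e0; rewrite -esP -ms.
  exists m => [|a]; rewrite -esP -ms ?mem_head // inE => /predU1P[->//|as_].
  by move: so; rewrite /= le_path_sortedE => /andP[/allP/(_ _ as_)].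
have lbm : lbound [set a : R | eigenvalue (adjmx R) a]%classic m.
  by move=> a; apply: lem.
suff -> : lambda_min R = m by [].
apply/eqP; rewrite eq_le; apply/andP; split.
- by apply: ge_inf => //; exists m.
- by apply: lb_le_inf => //; exists m.
Qed.
End LambdaMin.

Definition plex (p : nat) (P : {set G}) : Prop :=
  forall x, x \in P -> (#|[set y in P | (y != x) && ~~ adj x y]| <= p.-1)%N.

Section Induced.
Variable P : pred G.
Definition induced_adj : rel {x : G | P x} := fun x y => adj (val x) (val y).
Lemma induced_sym : symmetric induced_adj.
Proof. by move=> x y; apply: adj_sym. Qed.
Lemma induced_irr : irreflexive induced_adj.
Proof. by move=> x; apply: adj_irr. Qed.
Definition induced : sgraph := SGraph induced_sym induced_irr.
End Induced.
End Graphs.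

Definition giso (G1 G2 : sgraph) : Prop :=
  exists f : G1 -> G2,
    bijective f /\ (forall x y, adj (f x) (f y) = adj x y).

(* The vertices that are not fat are the slim ones. *)
Record hoffman := Hoffman {
  hgraph :> sgraph;
  fat : pred hgraph;
  fat_stable : forall x y : hgraph, fat x -> fat y -> ~~ adj x y;
  fat_slim : forall x : hgraph, fat x -> exists y, ~~ fat y /\ adj x y }.

Section HoffmanGraphs.
Variable h : hoffman.

Definition slim_graph : sgraph := induced (fun x : h => ~~ fat x).

Definition fat_nbrs (x : h) : {set h} := [set y | fat y & adj x y].

Definition tfat (t : nat) : Prop :=
  forall x : h, ~~ fat x -> (t <= #|fat_nbrs x|)%N.

(* U spans an induced Hoffman subgraph, i.e. the graph induced on U, with the
   restricted labeling, is a Hoffman graph. *)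
Definition hoffman_set (U : {set h}) : Prop :=
  forall x, x \in U -> fat x -> exists y, [/\ y \in U, ~~ fat y & adj x y].

Section HInduced.
Variables (U : {set h}) (hU : hoffman_set U).
Let GU := induced (fun x : h => x \in U).
Definition hinduced_fat : pred GU := fun x => fat (val x).
Lemma hinduced_stable (x y : GU) :
  hinduced_fat x -> hinduced_fat y -> ~~ adj x y.
Proof. exact: fat_stable. Qed.
Lemma hinduced_slim (x : GU) :
  hinduced_fat x -> exists y : GU, ~~ hinduced_fat y /\ adj x y.
Proof. by move=> /(hU (valP x)) [y [yU ? ?]]; exists (Sub y yU). Qed.
Definition hinduced : hoffman := Hoffman hinduced_stable hinduced_slim.
End HInduced.

Definition generated_set (W : {set slim_graph}) : {set h} :=
  [set val x | x in W] :|: [set y | fat y & [exists x in W, adj y (val x)]].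

Lemma generated_hoffman W : hoffman_set (generated_set W).
Proof.
move=> y; rewrite !inE => /orP[/imsetP[x _ ->]|].
  by rewrite (negPf (valP x)).
case/andP=> _ /existsP[x /andP[xW yx]] _; exists (val x); split=> //.
- by rewrite inE; apply/orP; left; apply: imset_f.
- exact: (valP x).
Qed.

Definition generated (W : {set slim_graph}) : hoffman :=
  hinduced (@generated_hoffman W).

Definition fatmx : 'M[int]_(#|slim_graph|, #|{: {x : h | fat x}}|) :=
  \matrix_(i, j) (adj (val (enum_val i)) (val (enum_val j)))%:R.

Definition special_mx : 'M[int]_#|slim_graph| :=
  adjmx slim_graph int - fatmx *m fatmx^T.

Definition special (x y : slim_graph) : int :=
  special_mx (enum_rank x) (enum_rank y).
End HoffmanGraphs.

Definition slim_incl (h : hoffman) (W : {set slim_graph h})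
    (x : slim_graph (generated W)) : slim_graph h :=
  exist _ (val (val x)) (valP x).

(* The family (generated W), for W in P, is a decomposition of h: S(h) vanishes
   outside of the diagonal blocks, and the block of W is S(generated W). *)
Definition decomposition (h : hoffman) (P : {set {set slim_graph h}}) : Prop :=
  [/\ finset.partition P [set: slim_graph h],
      forall W1 W2, W1 \in P -> W2 \in P -> W1 != W2 ->
        forall x y, x \in W1 -> y \in W2 -> special x y = 0
    & forall W, W \in P -> forall x y : slim_graph (generated W),
        special (slim_incl x) (slim_incl y) = special x y].

Definition hiso (h1 h2 : hoffman) : Prop :=
  exists f : h1 -> h2,
    [/\ bijective f, forall x y, adj (f x) (f y) = adj x y
      & forall x, fat (f x) = fat x].

Definition embeds (h1 h2 : hoffman) : Prop :=
  exists (U : {set h2}) (hU : hoffman_set U), hiso h1 (hinduced hU).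

(* h is identified with the subgraph of h' induced on U, so that h and h' have
   the same slim graph when U contains all slim vertices of h'. *)
Definition line_hoffman (H : hoffman -> Prop) (h : hoffman) : Prop :=
  exists h' : hoffman,
    (exists (U : {set h'}) (hU : hoffman_set U),
        hiso h (hinduced hU) /\ (forall x : h', ~~ fat x -> x \in U)) /\
    (exists P : {set {set slim_graph h'}},
        decomposition P /\
        (forall W, W \in P -> exists2 m, H m & embeds (generated W) m)).

(* The Hoffman graph with slim vertices S and fat vertices F, given by its
   slim-slim and slim-fat adjacencies. *)
Section SlimFat.
Variables (S F : finType) (e : rel S) (c : S -> F -> bool).
Hypotheses (e_sym : symmetric e) (e_irr : irreflexive e).
Hypothesis c_slim : forall y, exists x, c x y.
Definition sf_adj : rel (S + F)%type := fun u v =>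
  match u, v with
  | inl x, inl y => e x y
  | inl x, inr y => c x y
  | inr y, inl x => c x y
  | inr _, inr _ => false
  end.
Definition sf_fat : pred (S + F)%type := fun u => if u is inr _ then true else false.
Lemma sf_sym : symmetric sf_adj.
Proof. by case=> [x|x] [y|y] //=; apply: e_sym. Qed.
Lemma sf_irr : irreflexive sf_adj.
Proof. by case=> [x|x] //=; apply: e_irr. Qed.
Let SF := SGraph sf_sym sf_irr.
Lemma sf_stable (x y : SF) : sf_fat x -> sf_fat y -> ~~ adj x y.
Proof. by case: x y => [x|x] [y|y]. Qed.
Lemma sf_slim (x : SF) : sf_fat x -> exists y : SF, ~~ sf_fat y /\ adj x y.
Proof. by case: x => // y _; have [x cxy] := c_slim y; exists (inl x). Qed.
Definition slim_fat : hoffman := Hoffman sf_stable sf_slim.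
End SlimFat.

Definition f1_adj : rel unit := fun _ _ => false.
Definition f1_inc (_ : unit) (_ : 'I_3) : bool := true.
Lemma f1_sym : symmetric f1_adj. Proof. by []. Qed.
Lemma f1_irr : irreflexive f1_adj. Proof. by []. Qed.
Lemma f1_slim y : exists x, f1_inc x y. Proof. by exists tt. Qed.
Definition f1 : hoffman := slim_fat f1_sym f1_irr f1_slim.

(* Slim vertices: x_i is (false, i) and y_j is (true, j); fat vertices: F_ij is
   (i, j); indices are in bool instead of {1, 2}. *)
Definition f2_adj : rel (bool * bool) := fun u v => (u.1 == v.1) && (u.2 != v.2).
Definition f2_inc (u f : bool * bool) : bool :=
  if u.1 then f.2 == u.2 else f.1 == u.2.
Lemma f2_sym : symmetric f2_adj.
Proof. by move=> u v; rewrite /f2_adj eq_sym [u.2 == _]eq_sym. Qed.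
Lemma f2_irr : irreflexive f2_adj.
Proof. by move=> u; rewrite /f2_adj !eqxx. Qed.
Lemma f2_slim y : exists x, f2_inc x y.
Proof. by exists (false, y.1); rewrite /f2_inc /=. Qed.
Definition f2 : hoffman := slim_fat f2_sym f2_irr f2_slim.

Definition f3_adj : rel bool := fun x y => x != y.
Definition f3_inc (_ _ : bool) : bool := true.
Lemma f3_sym : symmetric f3_adj.
Proof. by move=> x y; rewrite /f3_adj eq_sym. Qed.
Lemma f3_irr : irreflexive f3_adj.
Proof. by move=> x; rewrite /f3_adj eqxx. Qed.
Lemma f3_slim y : exists x, f3_inc x y. Proof. by exists true. Qed.
Definition f3 : hoffman := slim_fat f3_sym f3_irr f3_slim.

Definition f123 (m : hoffman) : Prop := [\/ m = f1, m = f2 | m = f3].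

(* Main.v *)
(** Let x^T (A + 3 I) x be the form of G, nonnegative by the spectral theorem.
   For a clique C of a large fixed size N, every vertex has at most 12
   neighbours or at most 12 non-neighbours in C; let Q(C) be the set of vertices
   of the second kind. The fat vertices are the sets Q(C). Given an integer
   vector w, spreading the weight - sum_(x in Q) w x evenly over a clique
   defining Q, for each of finitely many Q, changes the form into
   w^T (S + 3 I) w up to O(1/N), where S is the special matrix. Hence S + 3 I is
   nonnegative on vectors of bounded support: Q(C) is a 5-plex, distinct sets
   Q(C) meet in few vertices of the cliques, no vertex lies in four of them, and
   S + 3 I is the Gram matrix of vectors that are zero (three fat neighbours) or
   of length one and pairwise equal, opposite or orthogonal (two fat neighbours).
   By Ramsey's theorem and the absence of induced stars with ten leaves, (ii)
   makes every vertex belong to two sets Q(C).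
   A class of equal vectors with no opposite one receives a new common fat
   vertex, after which each of its members is a copy of f1; a class with
   opposite vectors is a copy of f3 or an induced subgraph of f2. *)

Require Import Defs.
From HB Require Import structures.
From mathcomp Require Import all_boot all_order all_algebra.
From mathcomp Require Import classical_sets reals.
From mathcomp Require complex spectral.
From mathcomp Require Import fintype finset zify ring.

Set Implicit Arguments.
Unset Strict Implicit.
Unset Printing Implicit Defensive.

Import Order.TTheory GRing.Theory Num.Theory.
Local Open Scope ring_scope.

(** * Spectral lower bound for real symmetric forms *)

Section SymmetricForm.
Import complex spectral ComplexField.
Local Open Scope complex_scope.

(** Over [R[i]] a unitary [P] diagonalizes [A], and in the coordinates [w] the form is the sum of
    [d 0 j] times the squared modulus of [w 0 j]. Each [d 0 j] is real, hence an eigenvalue of [A]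
    over [R]. *)
Lemma sym_form_ge (R : rcfType) n (A : 'M[R]_n) (a : R) (v : 'rV[R]_n) :
    A^T = A -> (forall b, eigenvalue A b -> a <= b) ->
  a * (v *m v^T) 0 0 <= (v *m A *m v^T) 0 0.
Proof.
move=> AT ge_a; pose f : R -> R[i] := real_complex R.
have fR x : f x \is Num.real by apply/complex_realP; exists x.
have conjf m p (B : 'M[R]_(m, p)) : map_mx Num.conj (map_mx f B) = map_mx f B.
  by apply/matrixP=> i j; rewrite !mxE; apply/CrealP/fR.
pose B := map_mx f A.
have hermB : B \is hermsymmx.
  apply: realsym_hermsym; last by apply/mxOverP=> i j; rewrite mxE.
  by apply/is_hermitianmxP; rewrite expr0 scale1r map_mx_id // map_trmx AT.
have /orthomx_spectralP eB := hermitian_normalmx hermB.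
set P := spectralmx B in eB; set d := spectral_diag B in eB.
have Pu : P \in unitmx by apply: spectral_unit.
have iP : invmx P = (map_mx Num.conj P)^T.
  by rewrite invmx_unitary ?spectral_unitarymx // map_trmx.
have ge_d j : f a <= d 0 j.
  have /mxOverP/(_ 0 j) rd := hermitian_spectral_diag_real hermB.
  have [r df] : exists r, d 0 j = f r by apply/complex_realP.
  rewrite df lecR; apply: ge_a; rewrite -(eigenvalue_map f).
  rewrite -[X in eigenvalue _ X]/(f r) -[X in eigenvalue X _]/B -df.
  apply/eigenvalueP; exists (row j P).
    rewrite -row_mul eB !mulmxA mulmxV // mul1mx row_mul row_diag_mx.
    by rewrite -scalemxAl -rowE.
  apply/negP=> /eqP r0; have := row_free_unit P; rewrite Pu => rf.
  have : row j P *m invmx P = 0 by rewrite r0 mul0mx.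
  rewrite -row_mul mulmxV // => /matrixP/(_ 0 j); rewrite !mxE eqxx => /eqP.
  by rewrite oner_eq0.
pose u := map_mx f v; pose w := u *m invmx P.
have eu : u = w *m P by rewrite mulmxKV.
have wE : P *m u^T = map_mx Num.conj w^T.
  rewrite /w iP trmx_mul trmxK map_mxM -map_mx_comp (map_mx_id (@conjCK _)).
  by rewrite -map_trmx conjf.
have e1 : f ((v *m v^T) 0 0) = \sum_j w 0 j * (w 0 j)^*.
  have -> : f ((v *m v^T) 0 0) = (u *m u^T) 0 0.
    by rewrite /u map_trmx -map_mxM [RHS]mxE.
  rewrite [in X in X *m _]eu -mulmxA wE mxE.
  by apply: eq_bigr => j _; rewrite !mxE.
have e2 : f ((v *m A *m v^T) 0 0) = \sum_j d 0 j * (w 0 j * (w 0 j)^*).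
  have -> : f ((v *m A *m v^T) 0 0) = (u *m B *m u^T) 0 0.
    by rewrite /u map_trmx -!map_mxM [RHS]mxE.
  rewrite eB !mulmxA -/w -mulmxA wE mxE.
  apply: eq_bigr => j _; rewrite mul_mx_diag !mxE.
  by rewrite mulrCA mulrA.
suff: f (a * (v *m v^T) 0 0) <= f ((v *m A *m v^T) 0 0) by rewrite lecR.
have -> : f (a * (v *m v^T) 0 0) = f a * f ((v *m v^T) 0 0) by apply: rmorphM.
rewrite e1 e2 mulr_sumr ler_sum // => j _.
by rewrite ler_wpM2r // mul_conjC_ge0.
Qed.

End SymmetricForm.

(** * The form of A + 3 I on integer vectors *)

Section AdjacencyForm.
Variable G : sgraph.

Definition shifted_adj (x y : G) : int := (adj x y)%:Z + (x == y)%:Z *+ 3.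

Definition bform (u v : G -> int) : int :=
  \sum_x \sum_y u x * v y * shifted_adj x y.

Lemma bform_ge0 (R : realType) (u : G -> int) :
  -3 <= lambda_min G R -> 0 <= bform u u.
Proof.
(* [lambda_minP] needs a vertex; without one the form is an empty sum. *)
move=> lm; have [G0|Gpos] := posnP #|G|.
  by rewrite /bform big1 // => x; have := fintype0 x G0.
have [_ lmin] := lambda_minP R Gpos.
pose v : 'rV[R]_#|G| := \row_i (u (enum_val i))%:~R.
have AT : (adjmx G R)^T = adjmx G R.
  by apply/matrixP=> i j; rewrite !mxE adj_sym.
have := sym_form_ge v AT (fun b eb => le_trans lm (lmin b eb)).
rewrite -(ler_int R) mulNr -[leLHS]add0r lerBlDr; congr (_ <= _).
have -> : (v *m v^T) 0 0 =
    \sum_x \sum_y (u x)%:~R * (u y)%:~R * ((x == y)%:Z)%:~R :> R.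
  rewrite mxE (reindex _ (onW_bij _ (@enum_rank_bij G))) /=.
  apply: eq_bigr => x _; rewrite !mxE enum_rankK (bigD1 x) //= eqxx mulr1.
  by rewrite big1 ?addr0 // => y /negPf; rewrite eq_sym => ->; rewrite mulr0.
have -> : (v *m adjmx G R *m v^T) 0 0 =
    \sum_x \sum_y (u x)%:~R * (u y)%:~R * ((adj x y)%:Z)%:~R :> R.
  rewrite exchange_big /= mxE (reindex _ (onW_bij _ (@enum_rank_bij G))) /=.
  apply: eq_bigr => y _; rewrite !mxE enum_rankK big_distrl /=.
  rewrite (reindex _ (onW_bij _ (@enum_rank_bij G))) /=.
  by apply: eq_bigr => x _; rewrite !mxE !enum_rankK mulrAC.
rewrite mulr_sumr -big_split /= rmorph_sum /=; apply: eq_bigr => x _.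
rewrite mulr_sumr -big_split /= rmorph_sum /=; apply: eq_bigr => y _.
rewrite /shifted_adj !rmorphM /= rmorphD /= rmorphMn /= mulrDr; congr (_ + _).
by rewrite mulrnAr mulr_natl.
Qed.
End AdjacencyForm.

Lemma sum_Posz (I : finType) (P : pred I) (F : I -> nat) :
  \sum_(i | P i) (F i)%:Z = (\sum_(i | P i) F i)%:Z.
Proof. by rewrite (big_morph Posz PoszD (erefl _)). Qed.

Lemma subset_of_card (T : finType) (A : {set T}) n :
  (n <= #|A|)%N -> {B : {set T} | B \subset A & #|B| = n}.
Proof.
move=> nA; pose s := take n (enum A).
have us : uniq s by rewrite take_uniq ?enum_uniq.
exists [set x in s]; first by apply/subsetP=> x; rewrite inE => /mem_take; rewrite mem_enum.
by rewrite cardsE (card_uniqP us) size_takel -?cardE.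
Qed.

(** * The form on indicator vectors, and Ramsey's theorem *)

Section FormTheory.
Variable G : sgraph.
Implicit Types (u v w : G -> int) (A B C : {set G}) (x y : G).

Definition nbrs x : {set G} := [set y | adj x y].
Definition ind A x : int := (x \in A)%:Z.
Definition clique A : bool :=
  [forall x in A, forall y in A, (x != y) ==> adj x y].
Definition stable A : bool := [forall x in A, forall y in A, ~~ adj x y].

Lemma cliqueP A :
  reflect {in A &, forall x y, x != y -> adj x y} (clique A).
Proof.
apply: (iffP 'forall_in_'forall_in_implyP); first by move=> h x y *; apply: h.
by move=> h x xA y yA; apply: h.
Qed.

Lemma stableP A : reflect {in A &, forall x y, ~~ adj x y} (stable A).
Proof.
apply: (iffP 'forall_in_forall_inP); first by move=> h x y *; apply: h.
by move=> h x xA y yA; apply: h.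
Qed.

Lemma shifted_adjC x y : shifted_adj x y = shifted_adj y x.
Proof. by rewrite /shifted_adj adj_sym eq_sym. Qed.

Lemma bformC u v : bform u v = bform v u.
Proof.
rewrite /bform exchange_big /=; apply: eq_bigr => x _; apply: eq_bigr => y _.
by rewrite shifted_adjC [u y * _]mulrC.
Qed.

Lemma bformDl u u' v : bform (fun x => u x + u' x) v = bform u v + bform u' v.
Proof.
rewrite -big_split; apply: eq_bigr => x _ /=; rewrite -big_split.
by apply: eq_bigr => y _ /=; rewrite !mulrDl.
Qed.

Lemma bformZl a u v : bform (fun x => a * u x) v = a * bform u v.
Proof.
rewrite mulr_sumr; apply: eq_bigr => x _; rewrite mulr_sumr.
by apply: eq_bigr => y _; rewrite !mulrA.
Qed.

Lemma bformDr u v v' : bform u (fun x => v x + v' x) = bform u v + bform u v'.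
Proof. by rewrite bformC bformDl !(bformC u). Qed.

Lemma bformZr a u v : bform u (fun x => a * v x) = a * bform u v.
Proof. by rewrite bformC bformZl bformC. Qed.

Lemma bform_suml (I : finType) (P : pred I) (F : I -> G -> int) v :
  bform (fun x => \sum_(i | P i) F i x) v = \sum_(i | P i) bform (F i) v.
Proof.
rewrite exchange_big; apply: eq_bigr => x _ /=.
rewrite exchange_big; apply: eq_bigr => y _ /=.
by rewrite big_distrl big_distrl.
Qed.

Lemma bform_sumr (I : finType) (P : pred I) u (F : I -> G -> int) :
  bform u (fun x => \sum_(i | P i) F i x) = \sum_(i | P i) bform u (F i).
Proof. by rewrite bformC bform_suml; apply: eq_bigr => i _; apply: bformC. Qed.

Lemma sum_ind A u : \sum_x ind A x * u x = \sum_(x in A) u x.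
Proof.
rewrite [RHS]big_mkcond; apply: eq_bigr => x _; rewrite /ind.
by case: ifP => _; rewrite ?mul1r ?mul0r.
Qed.

Lemma sum_shifted_adj x A :
  \sum_(y in A) shifted_adj x y = #|A :&: nbrs x|%:Z + (x \in A)%:Z *+ 3.
Proof.
rewrite big_split /= sumrMnl; congr (_ + _ *+ 3).
  rewrite sum_Posz -sum1_card; congr (Posz _).
  rewrite [LHS]big_mkcond [RHS]big_mkcond; apply: eq_bigr => y _ /=.
  by rewrite !inE; case: (y \in A); case: adj.
rewrite (eq_bigr (fun y => (x == y)%:Z)) // sum_Posz; congr (Posz _).
have [xA|xA] := boolP (x \in A).
  rewrite (bigD1 x) //= eqxx big1 // => y /andP[_ /negPf].
  by rewrite eq_sym => ->.
by rewrite big1 // => y yA; case: eqP xA => // ->; rewrite yA.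
Qed.

Lemma bform_indr w A : bform w (ind A) =
  \sum_x w x * (#|A :&: nbrs x|%:Z + (x \in A)%:Z *+ 3).
Proof.
apply: eq_bigr => x _; rewrite -sum_shifted_adj -sum_ind mulr_sumr.
by apply: eq_bigr => y _; rewrite mulrA.
Qed.

Lemma bform_ind A B : bform (ind A) (ind B) =
  \sum_(x in A) (#|B :&: nbrs x|%:Z + (x \in B)%:Z *+ 3).
Proof. by rewrite bform_indr sum_ind. Qed.

Lemma bform_ind1 x A :
  bform (ind [set x]) (ind A) = #|A :&: nbrs x|%:Z + (x \in A)%:Z *+ 3.
Proof. by rewrite bform_ind big_set1. Qed.

Lemma bform_ind11 x y : bform (ind [set x]) (ind [set y]) = shifted_adj x y.
Proof. by rewrite bform_ind1 -sum_shifted_adj big_set1. Qed.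

Lemma bform_const A B k :
    {in A, forall x, #|B :&: nbrs x|%:Z + (x \in B)%:Z *+ 3 = k} ->
  bform (ind A) (ind B) = #|A|%:Z * k.
Proof. 
move=> Ak; rewrite bform_ind (eq_bigr (fun=> k)) //.
by rewrite sumr_const -mulr_natl natz.
Qed.

Lemma card_clique_non_nbrs A x :
  clique A -> x \in A -> (#|A :\: nbrs x| <= 1)%N.
Proof.
move=> /cliqueP cA xA; rewrite -(cards1 x); apply/subset_leq_card/subsetP=> y.
rewrite !inE => /andP[nxy yA].
by apply: contraR nxy => yx; apply: cA; rewrite // eq_sym.
Qed.

Lemma bform_clique A : clique A ->
  bform (ind A) (ind A) = #|A|%:Z * (#|A|%:Z + 2).
Proof.
move=> /cliqueP cA; apply: bform_const => x xA; rewrite xA.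
suff -> : A :&: nbrs x = A :\ x by rewrite (cardsD1 x A) xA; lia.
apply/setP=> y; rewrite !inE; have [yA|] := boolP (y \in A); last by rewrite andbF.
have [->|yx] := eqVneq y x; first by rewrite adj_irr.
by rewrite cA // eq_sym.
Qed.

Lemma bform_stable A : stable A -> bform (ind A) (ind A) = #|A|%:Z * 3.
Proof.
move=> /stableP sA; apply: bform_const => x xA; rewrite xA.
suff -> : A :&: nbrs x = set0 by rewrite cards0.
apply/setP=> y; rewrite !inE; have [yA|] := boolP (y \in A); last by [].
by rewrite /= (negPf (sA _ _ xA yA)).
Qed.

Lemma bform_ind_ge0 A B : 0 <= bform (ind A) (ind B).
Proof. by rewrite bform_ind sumr_ge0 // => x _; lia. Qed.

(** Induction on [s + t]: a vertex x of A has enough neighbours, or enough non-neighbours, in A to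
    apply the induction hypothesis, and x extends the clique or the stable set found there. *)
Lemma ramsey s t A : (2 ^ (s + t) <= #|A|)%N ->
  (exists C, [/\ C \subset A, #|C| = s & clique C]) \/
  (exists B, [/\ B \subset A, #|B| = t & stable B]).
Proof.
have [n] := ubnP (s + t)%N; elim: n s t A => // n IH [|s] t A.
  move=> _ _; left; exists set0; rewrite sub0set cards0; split=> //.
  by apply/cliqueP=> x y; rewrite inE.
case: t => [|t] stn leA.
  right; exists set0; rewrite sub0set cards0; split=> //.
  by apply/stableP=> x y; rewrite inE.
have /card_gt0P[x xA] : (0 < #|A|)%N by apply: leq_trans leA; rewrite expn_gt0.
have leS : (2 ^ (s + t.+1) + 2 ^ (s + t.+1) <= #|A|)%N.
  by move: leA; rewrite addSn expnS; lia.
have eA := cardsID (nbrs x) A.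
have [nA|nA] := leqP (2 ^ (s + t.+1)) #|A :&: nbrs x|.
  have [|[C [sC eC /cliqueP cC]]|[B [sB eB iB]]] := IH _ _ _ _ nA; first by lia.
    have xC : x \notin C.
      by apply/negP=> /(subsetP sC); rewrite !inE adj_irr andbF.
    left; exists (x |: C); split.
    - by rewrite subUset sub1set xA (subset_trans sC) ?subsetIl.
    - by rewrite cardsU1 xC eC.
    apply/cliqueP=> y z; rewrite !inE => /orP[/eqP->|yC] /orP[/eqP->|zC] yz.
    - by rewrite eqxx in yz.
    - by have := subsetP sC z zC; rewrite !inE => /andP[].
    - by have := subsetP sC y yC; rewrite !inE adj_sym => /andP[].
    - exact: cC.
  by right; exists B; split=> //; rewrite (subset_trans sB) ?subsetIl.
(* [A :\: nbrs x] still contains x; the strictness in [nA] pays for its removal. *)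
have {}nA : (2 ^ (s.+1 + t) <= #|(A :\: nbrs x) :\ x|)%N.
  have := cardsD1 x (A :\: nbrs x); rewrite !inE adj_irr xA /=.
  by rewrite (addSnnS s t); lia.
have sA : (A :\: nbrs x) :\ x \subset A.
  by rewrite (subset_trans (subsetDl _ _)) ?subsetDl.
have [|[C [sC eC cC]]|[B [sB eB /stableP iB]]] := IH _ _ _ _ nA; first by lia.
  by left; exists C; rewrite (subset_trans sC).
have xB : x \notin B by apply/negP=> /(subsetP sB); rewrite !inE eqxx.
right; exists (x |: B); split.
- by rewrite subUset sub1set xA (subset_trans sB).
- by rewrite cardsU1 xB eB.
have nx y : y \in B -> ~~ adj x y by move/(subsetP sB); rewrite !inE => /and3P[].
apply/stableP=> y z; rewrite !inE => /orP[/eqP->|yB] /orP[/eqP->|zB].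
- by rewrite adj_irr.
- exact: nx.
- by rewrite adj_sym nx.
- exact: iB.
Qed.

End FormTheory.

(** * Adjacency to large cliques *)

Section QuasiCliques.
Variables (G : sgraph) (N : nat).
Implicit Types (u v w : G -> int) (A B C Q : {set G}) (x y : G).
Hypothesis bform_psd : forall u, 0 <= bform u u.

Definition quasi C : {set G} := [set x | #|C :\: nbrs x| <= 12]%N.

Definition Nclique C := clique C && (#|C| == N).

(** With k neighbours A and k non-neighbours B of x in C, the vector 4 x - A + B has form 48 - 4 k,
    which is negative at k = 13. *)
Lemma nbrs_dichotomy C x : clique C ->
  (#|C :&: nbrs x| <= 12)%N \/ (#|C :\: nbrs x| <= 12)%N.
Proof.
move=> cC; apply/orP; rewrite -[_ || _]negbK negb_or -!ltnNge; apply/negP.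
case/andP=> /subset_of_card[A sA eA] leB.
have xC : x \notin C.
  by apply/negP=> /(card_clique_non_nbrs cC); lia.
have [B sB eB] := subset_of_card leB.
have /subsetIP[AC /subsetP An] := sA.
have /subsetP Bn := sB.
have BC : B \subset C by rewrite (subset_trans sB) ?subsetDl.
have cl (D : {set G}) : D \subset C -> clique D.
  move=> /subsetP DC; apply/cliqueP=> y z /DC yC /DC zC; exact: (cliqueP _ cC).
have AB y : y \in A -> B :&: nbrs y = B.
  move=> yA; apply/setIidPl/subsetP=> z zB; rewrite inE.
  apply: (cliqueP _ cC); [exact: (subsetP AC)|exact: (subsetP BC)|].
  apply/eqP=> yz; have := An _ yA; have := Bn _ zB.
  by rewrite -yz !inE => /andP[/negPf->].
have Bnot y : y \in A -> y \notin B.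
  move=> /An; rewrite inE => xy; apply/negP=> /Bn; rewrite !inE xy.
  by [].
have eAB : bform (ind A) (ind B) = 13 * 13.
  rewrite (@bform_const _ A B 13) ?eA // => y yA.
  by rewrite AB // eB (negPf (Bnot _ yA)).
have exA : bform (ind [set x]) (ind A) = 13.
  rewrite bform_ind1 (setIidPl _) ?eA ?(contraNF (subsetP AC x) xC) //.
  exact/subsetP.
have exB : bform (ind [set x]) (ind B) = 0.
  rewrite bform_ind1 (contraNF (subsetP BC x) xC) //.
  suff -> : B :&: nbrs x = set0 by rewrite cards0.
  apply/eqP; rewrite setI_eq0 disjoint_subset; apply/subsetP=> y /Bn.
  by rewrite !inE => /andP[].
have exx : bform (ind [set x]) (ind [set x]) = 3.
  by rewrite bform_ind11 /shifted_adj adj_irr eqxx.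
(* The vector 4 x - A + B has form 48 - 104 + 52 = -4. *)
have := bform_psd (fun y => 4 * ind [set x] y + (-1 * ind A y + ind B y)).
rewrite !(bformDl, bformDr, bformZl, bformZr) exx exA exB eAB.
rewrite [bform (ind A) (ind [set x])]bformC [bform (ind B) (ind [set x])]bformC.
rewrite [bform (ind B) (ind A)]bformC exA exB eAB !bform_clique ?cl // eA eB.
lia.
Qed.

Lemma card_stable_nbrs A x : A \subset nbrs x -> stable A -> (#|A| < 10)%N.
Proof.
move=> /subsetP An sA; rewrite ltnNge; apply/negP=> /subset_of_card[B /subsetP BA eB].
have sB : stable B.
  by apply/stableP=> y z /BA yA /BA zA; apply: (stableP _ sA).
have Bn : B \subset nbrs x by apply/subsetP=> y /BA /An.
have exB : bform (ind [set x]) (ind B) = 10.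
  rewrite bform_ind1 (setIidPl Bn) eB; case: (boolP (x \in B)) => // xB.
  by have := subsetP Bn _ xB; rewrite inE adj_irr.
have exx : bform (ind [set x]) (ind [set x]) = 3.
  by rewrite bform_ind11 /shifted_adj adj_irr eqxx.
(* For an induced star with ten leaves B, the vector 3 x - B has form 27 - 60 + 30 = -3. *)
have := bform_psd (fun y => 3 * ind [set x] y + -1 * ind B y).
rewrite !(bformDl, bformDr, bformZl, bformZr) exx exB bform_stable // eB.
by rewrite bformC exB.
Qed.

(** Up to 12, the form pairs x with C as N or 0 according to membership in [quasi C]. Members of C
    miss only themselves; the other vertices obey the dichotomy. *)
Lemma Nclique_row C x : Nclique C -> (12 < N)%N ->
  `| #|C :&: nbrs x|%:Z + (x \in C)%:Z *+ 3 - (x \in quasi C)%:Z * N%:Z| <= 12.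
Proof.
case/andP=> cC /eqP eC N12.
have eN := cardsID (nbrs x) C; rewrite eC in eN.
have [xC|xC] := boolP (x \in C).
  have sx := card_clique_non_nbrs cC xC.
  by rewrite inE; case: leqP; lia.
rewrite inE; case: leqP; first by lia.
by have [] := nbrs_dichotomy x cC; lia.
Qed.

(* The form is evaluated at N w minus, for each i, the clique [C i] with
   constant weight [\sum_(x in quasi (C i)) w x]; 54 = 2 * 12 + 30 bounds the error
   terms of order N. *)
Lemma quasi_form_ge (I : finType) (A : {set I}) (C : I -> {set G}) w (W : nat) :
    (forall i, i \in A -> Nclique (C i)) ->
    {in A &, forall i j, i != j ->
       bform (ind (C i)) (ind (C j)) <= 30 * N%:Z} ->
    \sum_x `|w x| <= W%:Z -> (54 * (W * W) * (#|A| * #|A|) < N)%N ->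
    (12 < N)%N ->
  \sum_(i in A) (\sum_(x in quasi (C i)) w x) ^+ 2 <= bform w w.
Proof.
move=> NC far wW ltN N12; rewrite leNgt; apply/negP=> lt.
pose c i : int := \sum_(x in quasi (C i)) w x.
have cW i : `|c i| <= W%:Z.
  apply: le_trans wW; apply: le_trans (ler_norm_sum _ _ _) _.
  by rewrite [leRHS](bigID [in quasi (C i)]) lerDl sumr_ge0.
have ccW i j : `|c i * c j| <= (W * W)%N%:Z.
  by rewrite normrM PoszM ler_pM.
have cross i : i \in A ->
    c i ^+ 2 * N%:Z - 12 * (W * W)%N%:Z <= c i * bform w (ind (C i)).
  move=> iA; pose r x : int := #|C i :&: nbrs x|%:Z + (x \in C i)%:Z *+ 3
    - (x \in quasi (C i))%:Z * N%:Z.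
  have -> : bform w (ind (C i)) = c i * N%:Z + \sum_x w x * r x.
    rewrite bform_indr /c -sum_ind mulr_suml -big_split.
    by apply: eq_bigr => x _; rewrite mulrBr mulrA [_ * w x]mulrC [RHS]addrC subrK.
  have rW : `|\sum_x w x * r x| <= 12 * W%:Z.
    apply: le_trans (ler_norm_sum _ _ _) _.
    apply: (le_trans (y := \sum_x 12 * `|w x|)); last by rewrite -mulr_sumr ler_wpM2l.
    by apply: ler_sum => x _; rewrite normrM mulrC ler_wpM2r // Nclique_row // NC.
  have : `|c i * \sum_x w x * r x| <= 12 * (W * W)%N%:Z.
    rewrite normrM (le_trans (ler_pM _ _ (cW i) rW)) //; lia.
  by rewrite mulrDr mulrA -expr2; lia.
(* On the diagonal N (N + 2) exceeds N^2 by 2 N, which the error term for distinct cliques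
   absorbs. *)
have pair i j : i \in A -> j \in A ->
    c i * c j * bform (ind (C i)) (ind (C j)) <=
    (if i == j then c i ^+ 2 * (N * N)%N%:Z else 0) + 30 * (W * W * N)%N%:Z.
  move=> iA jA; have ccWij := ccW i j; case: eqP ccWij => [<- ccWii|/eqP ij ccWij].
    have /andP[cC /eqP eC] := NC i iA; rewrite bform_clique // eC.
    have : c i * c i * N%:Z <= (W * W)%N%:Z * N%:Z by rewrite ler_wpM2r //; lia.
    by rewrite expr2 !PoszM; nia.
  have b0 := bform_ind_ge0 (C i) (C j); have b30 := far i j iA jA ij.
  apply: (le_trans (ler_norm _)); rewrite add0r normrM.
  apply: (le_trans (ler_pM _ _ ccWij (_ : _ <= 30 * N%:Z))) => //.
    by rewrite ger0_norm.
  by rewrite !PoszM; lia.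
pose p x := \sum_(i in A) c i * ind (C i) x.
have eX : bform w p = \sum_(i in A) c i * bform w (ind (C i)).
  by rewrite bform_sumr; apply: eq_bigr => i _; rewrite bformZr.
have eY : bform p p =
    \sum_(i in A) \sum_(j in A) c i * c j * bform (ind (C i)) (ind (C j)).
  rewrite bform_suml; apply: eq_bigr => i _; rewrite bform_sumr.
  by apply: eq_bigr => j _; rewrite bformZl bformZr mulrA.
pose S : int := \sum_(i in A) c i ^+ 2; pose f : int := #|A|%:Z.
have hX : S * N%:Z - 12 * (W * W)%N%:Z * f <= bform w p.
  rewrite eX; apply: le_trans (ler_sum _ cross).
  by rewrite sumrB -mulr_suml sumr_const -[_ *+ #|A|]mulr_natr (natz #|A|).
have hY : bform p p <= S * (N * N)%N%:Z + 30 * (W * W * N)%N%:Z * f * f.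
  set k := 30 * _; have sumk a : \sum_(i in A) (a i + k * f) = \sum_(i in A) a i + k * f * f.
    by rewrite big_split sumr_const -[_ *+ #|A|]mulr_natr (natz #|A|).
  rewrite eY /S mulr_suml -sumk ler_sum // => i iA.
  apply: le_trans (ler_sum _ (fun j jA => pair i j iA jA)) _.
  rewrite big_split sumr_const -[_ *+ #|A|]mulr_natr (natz #|A|) lerD2r.
  rewrite (bigD1 i) //= eqxx big1 ?addr0 // => j /andP[_ /negPf].
  by rewrite eq_sym => ->.
(* Integrality turns [lt] into a gap of 1. With it the form of N w - p is at most - N^2 + 24 N W^2 f
   + 30 N W^2 f^2, which [ltN] makes negative. *)
have hB : bform w w <= S - 1 by move: lt; rewrite -/S; lia.
have := bform_psd (fun x => N%:Z * w x + -1 * p x).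
rewrite !(bformDl, bformDr, bformZl, bformZr) (bformC p w).
have hX' : N%:Z * (S * N%:Z - 12 * (W * W)%N%:Z * f) <= N%:Z * bform w p.
  by rewrite ler_wpM2l.
have hB' : (N * N)%N%:Z * bform w w <= (N * N)%N%:Z * (S - 1).
  by rewrite ler_wpM2l.
have hN : N%:Z * (54 * (W * W)%N%:Z * (f * f) + 1) <= N%:Z * N%:Z.
  by rewrite ler_wpM2l //; move: ltN; rewrite /f; lia.
have hf : (N * (W * W))%N%:Z * f <= (N * (W * W))%N%:Z * (f * f).
  by rewrite ler_wpM2l // /f; nia.
move: (W * W)%N hX' hB' hY hN hf => q; rewrite !PoszM; lia.
Qed.
End QuasiCliques.

(** * Quasi-cliques as fat vertices *)

Section Fats.
Variables (G : sgraph) (N : nat).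
Implicit Types (u v w : G -> int) (A B C Q : {set G}) (x y : G).
Hypothesis bform_psd : forall u, 0 <= bform u u.
(** The test vectors have l1-norm at most 3, whence 9, and meet at most nine fat vertices, whence
    81. The bound also covers norm 15 with a single clique, as 225 < 729. *)
Hypothesis N_large : (54 * (9 * 81) < N)%N.

Let N12 : (12 < N)%N. Proof. lia. Qed.

Lemma Nclique_sub_quasi C : Nclique N C -> C \subset quasi C.
Proof.
case/andP=> cC _; apply/subsetP=> x xC; rewrite inE.
by rewrite (leq_trans (card_clique_non_nbrs cC xC)).
Qed.

Lemma sum_ind1 A x : \sum_(y in A) ind [set x] y = (x \in A)%:Z.
Proof.
have [xA|xA] := boolP (x \in A).
  rewrite (bigD1 x) //= /ind inE eqxx big1 // => y /andP[_ /negPf yx].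
  by rewrite inE yx.
by rewrite big1 // => y yA; rewrite /ind inE; case: eqP xA => // <-; rewrite yA.
Qed.

Lemma sum_ind1T x : \sum_y ind [set x] y = 1.
Proof.
rewrite (eq_bigl [in [set: G]]) => [|y]; last by rewrite inE.
by rewrite sum_ind1 inE.
Qed.

Lemma sum_ind_sub A B : B \subset A -> \sum_(x in A) ind B x = #|B|%:Z.
Proof.
move=> /subsetP BA; rewrite -sum1_card -sum_Posz.
rewrite [LHS]big_mkcond [RHS]big_mkcond; apply: eq_bigr => x _ /=.
by rewrite /ind; case: (boolP (x \in B)) => [/BA->|] //; rewrite if_same.
Qed.

(** If x has five non-neighbours Z in [quasi C], then 5 x + 2 Z sums to 15 there, so its form should
    be at least 225; but it is at most 25 * 3 + 4 * 35, where 35 = 5 * (4 + 3) bounds the form of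
    Z. *)
Lemma quasi_plex C : Nclique N C -> plex 5 (quasi C).
Proof.
move=> NC x xQ /=; rewrite leqNgt; apply/negP=> /subset_of_card[Z /subsetP sZ eZ].
have ZQ : Z \subset quasi C by apply/subsetP=> y /sZ; rewrite inE => /andP[].
have xZ : x \notin Z by apply/negP=> /sZ; rewrite !inE eqxx andbF.
pose w y := 5 * ind [set x] y + 2 * ind Z y.
have exx : bform (ind [set x]) (ind [set x]) = 3.
  by rewrite bform_ind11 /shifted_adj adj_irr eqxx.
have exZ : bform (ind [set x]) (ind Z) = 0.
  rewrite bform_ind1 (negPf xZ); suff -> : Z :&: nbrs x = set0 by rewrite cards0.
  apply/eqP; rewrite setI_eq0 disjoint_subset; apply/subsetP=> y /sZ.
  by rewrite !inE => /and3P[].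
have eZZ : bform (ind Z) (ind Z) <= 35.
  rewrite bform_ind (le_trans (ler_sum _ (G := fun=> 7) _)) //; last first.
    by rewrite sumr_const eZ.
  move=> y yZ; rewrite yZ.
  have : (#|Z :&: nbrs y| <= #|Z :\ y|)%N.
    apply/subset_leq_card/subsetP=> z; rewrite !inE => /andP[-> yz].
    by rewrite andbT; apply: contraTneq yz => ->; rewrite adj_irr.
  by have := cardsD1 y Z; rewrite yZ eZ; lia.
have ww : bform w w <= 215.
  rewrite !(bformDl, bformDr, bformZl, bformZr) (bformC (ind Z)) exx exZ; lia.
have sw A : \sum_(y in A) w y = 5 * (x \in A)%:Z + 2 * \sum_(y in A) ind Z y.
  by rewrite big_split /= -!mulr_sumr sum_ind1.
have eS : \sum_(i in [set: unit]) (\sum_(y in quasi C) w y) ^+ 2 = 225.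
  by rewrite sumr_const cardsT card_unit sw sum_ind_sub // xQ eZ.
suff : 225 <= bform w w by lia.
rewrite -eS; apply: (@quasi_form_ge _ N bform_psd _ _ (fun=> C) _ 15) => //.
- rewrite (eq_bigr w) => [|y _]; last by rewrite ger0_norm /w /ind; lia.
  rewrite (eq_bigl [in [set: G]]) => [|y]; last by rewrite inE.
  by rewrite sw inE sum_ind_sub ?eZ ?subsetT.
- by rewrite cardsT card_unit; lia.
Qed.

(** By the plex property, x in [quasi C] is adjacent to at least 18 - 1 - 4 = 13 vertices of C', so
    the dichotomy puts it in [quasi C']. *)
Lemma quasi_sub C C' : Nclique N C -> Nclique N C' ->
  (18 <= #|quasi C :&: C'|)%N -> quasi C \subset quasi C'.
Proof.
move=> NC NC' le18; apply/subsetP=> x xQ; rewrite inE.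
have /andP[cC' _] := NC'; have [|//] := nbrs_dichotomy bform_psd x cC'.
have := quasi_plex NC xQ; rewrite /=.
set P := [set _ in _ | _] => leP leC.
suff : (#|quasi C :&: C'| <= 1 + #|P| + #|C' :&: nbrs x|)%N by lia.
have sub : quasi C :&: C' \subset [set x] :|: P :|: (C' :&: nbrs x).
  apply/subsetP=> y; rewrite !inE => /andP[-> ->] /=.
  by case: eqP; case: adj.
have := subset_leq_card sub; have := (leq_card_setU [set x] P).1.
have := (leq_card_setU ([set x] :|: P) (C' :&: nbrs x)).1.
by rewrite cards1; lia.
Qed.

(** One inclusion puts C inside [quasi C']; the two then meet in N vertices, and the reverse
    inclusion follows. *)
Lemma quasi_neq C C' : Nclique N C -> Nclique N C' -> quasi C <> quasi C' ->
  (#|quasi C :&: C'| <= 17)%N.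
Proof.
move=> NC NC' neq; rewrite leqNgt; apply/negP=> le18; apply: neq.
have sub := quasi_sub NC NC' le18; apply/eqP; rewrite eqEsubset sub /=.
apply: quasi_sub => //; have sC := Nclique_sub_quasi NC.
by rewrite (setIidPr (subset_trans sC sub)); case/andP: NC => _ /eqP->; lia.
Qed.

Lemma bform_quasi_neq C C' : Nclique N C -> Nclique N C' ->
  quasi C <> quasi C' -> bform (ind C) (ind C') <= 30 * N%:Z.
Proof.
move=> NC NC' neq; have le17 : (#|quasi C' :&: C| <= 17)%N.
  by apply: quasi_neq => // /esym.
have /andP[cC /eqP eC] := NC; have /andP[cC' /eqP eC'] := NC'.
rewrite bform_ind (bigID [in quasi C']) /=.
(* At most 17 vertices of C lie in [quasi C'] and contribute at most N + 13 each; the others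
   contribute at most 12 each. Here 221 = 17 * 13. *)
have -> : 30 * N%:Z = 17 * (N%:Z + 13) + N%:Z * 12 + (N%:Z - 221) by ring.
rewrite -[leLHS]addr0 lerD //; last by lia.
have row x := Nclique_row bform_psd x NC' N12.
apply: lerD.
  apply: (le_trans (y := \sum_(x in C | x \in quasi C') (N%:Z + 13))).
    by apply: ler_sum => x /andP[_ xQ]; have := row x; rewrite xQ; lia.
  rewrite sumr_const -[_ *+ _]mulr_natl (natz #|_|) ler_wpM2r //.
  rewrite (eq_card (B := quasi C' :&: C)); first by lia.
  by move=> x; rewrite [RHS]inE andbC.
apply: (le_trans (y := \sum_(x in C | x \notin quasi C') 12)).
  by apply: ler_sum => x /andP[_ xQ]; have := row x; rewrite (negPf xQ); lia.
rewrite sumr_const -[_ *+ _]mulr_natl (natz #|_|) ler_wpM2r // -eC.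
by apply/subset_leq_card/subsetP=> x /andP[].
Qed.

Definition fats : {set {set G}} := [set quasi C | C in [pred C | Nclique N C]].
Definition fats_at x : {set {set G}} := [set Q in fats | x \in Q].
Definition special_at x y : int := (adj x y)%:Z - #|fats_at x :&: fats_at y|%:Z.

Lemma fats_form_ge (F : {set {set G}}) w :
    F \subset fats -> (#|F| <= 9)%N -> \sum_x `|w x| <= 3 ->
  \sum_(Q in F) (\sum_(x in Q) w x) ^+ 2 <= bform w w.
Proof.
move=> /subsetP sF F9 w3.
(* One defining clique is chosen for each fat vertex; the default [set0] does not occur on F. *)
pose C Q := odflt set0 [pick C | Nclique N C && (quasi C == Q)].
have CP Q : Q \in F -> Nclique N (C Q) /\ quasi (C Q) = Q.
  move=> /sF/imsetP[D ND ->]; rewrite /C; case: pickP => [E /andP[? /eqP]|] //=.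
  by move/(_ D); rewrite eqxx andbT; case/negP.
have -> : \sum_(Q in F) (\sum_(x in Q) w x) ^+ 2 =
    \sum_(Q in F) (\sum_(x in quasi (C Q)) w x) ^+ 2.
  by apply: eq_bigr => Q /CP[_ ->].
apply: (@quasi_form_ge _ N bform_psd _ _ _ _ 3) => //; first by move=> Q /CP[].
  move=> Q Q' /CP[NQ eQ] /CP[NQ' eQ'] /eqP neq; apply: bform_quasi_neq => //.
  by rewrite eQ eQ'.
have : (#|F| * #|F| <= 81)%N by rewrite (leq_mul F9 F9).
lia.
Qed.

(** The vector x has form 3, and each fat vertex at x adds 1 to the lower bound. *)
Lemma card_fats_at x : (#|fats_at x| <= 3)%N.
Proof.
rewrite leqNgt; apply/negP=> /subset_of_card[F /subsetP sF eF].
have eS : \sum_(Q in F) (\sum_(y in Q) ind [set x] y) ^+ 2 = 4.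
  rewrite (eq_bigr (fun=> 1)) ?sumr_const ?eF // => Q /sF.
  by rewrite !inE sum_ind1 => /andP[_ ->].
suff : 4 <= bform (ind [set x]) (ind [set x]).
  by rewrite bform_ind11 /shifted_adj adj_irr eqxx.
rewrite -eS; apply: fats_form_ge; rewrite ?eF //.
  by apply/subsetP=> Q /sF; rewrite inE => /andP[].
rewrite (eq_bigr (ind [set x])) => [|y _]; last by rewrite /ind; lia.
by rewrite sum_ind1T.
Qed.

(* The matrix S + 3 I of the Hoffman graph whose fat vertices are [fats]. *)
Definition gram_at x y : int := special_at x y + (x == y)%:Z *+ 3.

(** This is [fats_form_ge] for a x + b y + c z, with F all the fat vertices at x, y or z. The three
    vertices may coincide. *)
Lemma gram_at_psd x y z (a b c : int) :
    `|a| <= 1 -> `|b| <= 1 -> `|c| <= 1 ->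
  0 <= a * a * gram_at x x + b * b * gram_at y y + c * c * gram_at z z
       + 2 * (a * b * gram_at x y + a * c * gram_at x z + b * c * gram_at y z).
Proof.
move=> a1 b1 c1.
pose F := fats_at x :|: fats_at y :|: fats_at z.
pose w t := a * ind [set x] t + (b * ind [set y] t + c * ind [set z] t).
have sF : F \subset fats.
  by apply/subsetP=> Q; rewrite !inE => /orP[/orP[]|] /andP[].
have F9 : (#|F| <= 9)%N.
  have := (leq_card_setU (fats_at x) (fats_at y)).1.
  have := (leq_card_setU (fats_at x :|: fats_at y) (fats_at z)).1.
  rewrite -/F; have := card_fats_at x; have := card_fats_at y; have := card_fats_at z; lia.
have sw A : \sum_(t in A) w t =
    a * (x \in A)%:Z + (b * (y \in A)%:Z + c * (z \in A)%:Z).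
  by rewrite !big_split /= -!mulr_sumr !sum_ind1.
have w3 : \sum_t `|w t| <= 3.
  apply: (le_trans (y := \sum_t (ind [set x] t + (ind [set y] t + ind [set z] t)))).
    by apply: ler_sum => t _; rewrite /w /ind; nia.
  by rewrite !big_split /= !sum_ind1T.
have cF s t : s \in [:: x; y; z] ->
    \sum_(Q in F) (s \in Q)%:Z * (t \in Q)%:Z = #|fats_at s :&: fats_at t|%:Z.
  move=> sxyz; rewrite -sum1_card -sum_Posz [LHS]big_mkcond [RHS]big_mkcond.
  apply: eq_bigr => Q _; rewrite !inE.
  by move: sxyz; rewrite !inE => /or3P[]/eqP->;
    case: (Q \in fats); case: (x \in Q); case: (y \in Q); case: (z \in Q);
    case: (t \in Q).
have := fats_form_ge sF F9 w3.
have -> : \sum_(Q in F) (\sum_(t in Q) w t) ^+ 2 =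
    a * a * #|fats_at x :&: fats_at x|%:Z + b * b * #|fats_at y :&: fats_at y|%:Z
    + c * c * #|fats_at z :&: fats_at z|%:Z
    + 2 * (a * b * #|fats_at x :&: fats_at y|%:Z
           + a * c * #|fats_at x :&: fats_at z|%:Z
           + b * c * #|fats_at y :&: fats_at z|%:Z).
  rewrite -!cF ?inE ?eqxx ?orbT // !mulr_sumr -!big_split /= !mulr_sumr.
  rewrite -!big_split /=; apply: eq_bigr => Q _; rewrite sw; ring.
rewrite !(bformDl, bformDr, bformZl, bformZr) !bform_ind11.
rewrite (shifted_adjC y x) (shifted_adjC z x) (shifted_adjC z y).
rewrite -subr_ge0 /gram_at /special_at /shifted_adj; congr (0 <= _); ring.
Qed.

(** Ramsey's theorem is applied with t = 10, since ten independent neighbours of x are excluded. A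
    clique inside the neighbourhood of x contains no non-neighbour of x. *)
Lemma exists_Nclique x A : A \subset nbrs x -> (2 ^ (N + 10) <= #|A|)%N ->
  exists C, [/\ C \subset A, Nclique N C & x \in quasi C].
Proof.
move=> sA /ramsey[] [C [sC eC]]; last first.
  move=> stC; have := card_stable_nbrs bform_psd (subset_trans sC sA) stC.
  by rewrite eC.
move=> cC; exists C; rewrite /Nclique cC eC eqxx; split=> //.
rewrite inE; suff -> : C :\: nbrs x = set0 by rewrite cards0.
by apply/eqP; rewrite setD_eq0 (subset_trans sC).
Qed.

(** The plex bound leaves 2^(N + 10) neighbours of x outside a first quasi-clique. A clique D found
    among them lies in [quasi D], which therefore differs from the first. *)
Lemma card_fats_at_ge2 x :
    (2 ^ (N + 10) < deg x)%N ->
    (forall P : {set G}, plex 5 P -> x \in P ->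
       (#|P| <= deg x - 2 ^ (N + 10))%N) ->
  (2 <= #|fats_at x|)%N.
Proof.
move=> degx plexP.
have [C [sC NC xC]] := exists_Nclique (subxx _) (ltnW degx).
have le := plexP _ (quasi_plex NC) xC.
have [||D [sD ND xD]] := @exists_Nclique x (nbrs x :\: quasi C).
- exact: subsetDl.
- have := cardsID (quasi C) (nbrs x); rewrite -[#|nbrs x|]/(deg x).
  have : (#|nbrs x :&: quasi C| <= #|quasi C|)%N.
    by rewrite subset_leq_card ?subsetIr.
  lia.
have neq : quasi D != quasi C.
  have /andP[_ /eqP eD] := ND.
  have /card_gt0P[y yD] : (0 < #|D|)%N by rewrite eD; lia.
  have yQ := subsetP (Nclique_sub_quasi ND) _ yD.
  have := subsetP sD _ yD; rewrite inE => /andP[nyC _].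
  by apply: contraNneq nyC => <-.
suff : (#|[set quasi D; quasi C]| <= #|fats_at x|)%N by rewrite cards2 neq.
apply/subset_leq_card/subsetP=> Q; rewrite !inE => /orP[]/eqP->.
  by rewrite xD andbT; apply: imset_f.
by rewrite xC andbT; apply: imset_f.
Qed.
End Fats.

(** * Special matrices and embeddings of Hoffman graphs *)

Lemma specialE (h : hoffman) (x y : slim_graph h) :
  special x y = (adj x y)%:Z - #|fat_nbrs (val x) :&: fat_nbrs (val y)|%:Z.
Proof.
rewrite /special !mxE !enum_rankK natz; congr (_ - _).
rewrite (reindex _ (onW_bij _ (@enum_rank_bij {x : h | fat x}))) /=.
rewrite (eq_bigr (fun f : {x : h | fat x} =>
    (adj (val x) (val f) && adj (val y) (val f))%:Z)); last first.
  by move=> f _; rewrite !mxE !enum_rankK; case: adj; case: adj.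
rewrite sum_Posz -[RHS]/(Posz _); congr Posz.
rewrite (eq_bigr (fun f : {x : h | fat x} =>
    if adj (val x) (val f) && adj (val y) (val f) then 1 else 0)%N); last first.
  by move=> f _; case: ifP.
rewrite -big_mkcond sum1_card -(card_imset _ val_inj); apply: eq_card => f.
rewrite !inE; apply/imsetP/andP=> [[g /andP[xg yg] ->]|[/andP[ff xf] /andP[_ yf]]].
  by rewrite xg yg (valP g).
by exists (Sub f ff) => //; apply/andP.
Qed.

Lemma fat_nbrs_generated (h : hoffman) (W : {set slim_graph h})
    (x : generated W) : ~~ fat x ->
  fat_nbrs (val x) = [set val f | f in fat_nbrs x].
Proof.
move=> nfx; apply/setP=> f; apply/idP/imsetP; last first.
  by case=> g; rewrite !inE => ? ->.
rewrite inE => /andP[ff xf].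
have fW : f \in generated_set W.
  rewrite !inE ff; apply/orP; right; apply/existsP.
  have := valP x; rewrite !inE => /orP[/imsetP[y yW xy]|]; last first.
    by rewrite [fat _](negPf nfx).
  by exists y; rewrite yW -xy adj_sym.
by exists (Sub f fW) => //; rewrite inE; apply/andP.
Qed.

(** A generated subgraph keeps every fat neighbour of its slim vertices, so the diagonal blocks are
    right for any W. *)
Lemma special_generated (h : hoffman) (W : {set slim_graph h})
    (x y : slim_graph (generated W)) :
  special (slim_incl x) (slim_incl y) = special x y.
Proof.
rewrite !specialE; congr (_ - Posz _).
rewrite (fat_nbrs_generated (valP x)) (fat_nbrs_generated (valP y)).
by rewrite -imsetI ?card_imset //; [exact: val_inj|move=> ? ? _ _; exact: val_inj].
Qed.

Lemma embeds_inj (h1 h2 : hoffman) (g : h1 -> h2) :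
    injective g -> (forall x y, adj (g x) (g y) = adj x y) ->
    (forall x, fat (g x) = fat x) ->
  embeds h1 h2.
Proof.
move=> gI gadj gfat; pose U := [set g x | x in [set: h1]].
have gU x : g x \in U by apply: imset_f.
have hU : hoffman_set U.
  move=> _ /imsetP[x _ ->]; rewrite gfat => /fat_slim[y [sy xy]].
  by exists (g y); rewrite gU gfat gadj.
exists U, hU, (fun x => Sub (g x) (gU x)); split=> [|x y|x]; last 2 first.
- exact: gadj.
- exact: gfat.
apply: inj_card_bij => [x y /(congr1 val) /= /gI //|].
rewrite card_sig (eq_card (B := U)) => [|x]; last by rewrite !inE.
by rewrite card_imset // cardsT.
Qed.

Lemma hiso_setT (h : hoffman) (hU : hoffman_set [set: h]) : hiso h (hinduced hU).
Proof.
exists (fun x => Sub x (in_setT x)); split=> //.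
by exists val => [x|[x xT]]; [|apply: val_inj].
Qed.

(** * Hoffman graphs given by the fat neighbourhoods of slim vertices *)

Section SlimFat.
Variables (S F : finType) (e : rel S) (c : S -> {set F}).
Hypotheses (e_sym : symmetric e) (e_irr : irreflexive e).

(** A Hoffman graph has no fat vertex without a slim neighbour, so the elements of F outside every
    [c x] are dropped. *)
Definition used : pred F := [pred f | [exists x, f \in c x]].
Definition incidence (x : S) (f : {f | used f}) : bool := val f \in c x.

Lemma incidence_slim f : exists x, incidence x f.
Proof. by have /existsP := valP f. Qed.

Definition inc_hoffman := slim_fat e_sym e_irr incidence_slim.
Local Notation h := inc_hoffman.

Definition slim_of (x : S) : slim_graph h := exist _ (inl x) isT.
Definition of_slim (u : slim_graph h) : S :=
  match u with
  | exist (inl x) _ => x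
  | exist (inr f) p => match notF p with end
  end.

Lemma of_slimK : cancel of_slim slim_of.
Proof. by case=> [[x|f] p] //; apply: val_inj. Qed.

Lemma giso_inc : giso (SGraph e_sym e_irr) (slim_graph h).
Proof. by exists slim_of; split=> //; exists of_slim; [|exact: of_slimK]. Qed.

Lemma used_inc x f : f \in c x -> used f.
Proof. by move=> fx; apply/existsP; exists x. Qed.

Lemma fat_nbrs_inc x y :
  #|fat_nbrs (inl x : h) :&: fat_nbrs (inl y : h)| = #|c x :&: c y|.
Proof.
pose g (v : h) : option F := if v is inr f then Some (val f) else None.
rewrite -(card_in_imset (f := g)); last first.
  move=> [u|u] [v|v]; rewrite !inE // => _ _ [] /val_inj -> //.
rewrite -[RHS](card_imset _ (@Some_inj _)); apply: eq_card => o.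
apply/imsetP/imsetP=> [[[u|u]]|[f]]; rewrite !inE //.
  by move=> /andP[/= xu yu] ->; exists (val u) => //; rewrite inE; apply/andP.
move=> /andP[xf yf] ->; exists (inr (Sub f (used_inc xf))) => //.
by rewrite !inE; apply/andP.
Qed.

Lemma special_inc u v : special u v =
  (e (of_slim u) (of_slim v))%:Z - #|c (of_slim u) :&: c (of_slim v)|%:Z.
Proof.
rewrite specialE -fat_nbrs_inc.
by rewrite -[u in LHS]of_slimK -[v in LHS]of_slimK.
Qed.

Lemma tfat_inc t : (forall x, (t <= #|c x|)%N) -> tfat h t.
Proof.
move=> tc [x|f] // _; have := tc x.
by rewrite -[c x]setIid -fat_nbrs_inc setIid.
Qed.

Definition slim_set (B : {set S}) : {set slim_graph h} :=
  [set u | of_slim u \in B].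

(** The hypotheses concern only B and the fat vertices met by B, which are the vertices of the
    generated subgraph. *)
Lemma embeds_inc (S' F' : finType) (e' : rel S') (c' : S' -> F' -> bool)
    (e'_sym : symmetric e') (e'_irr : irreflexive e')
    (c'_slim : forall f, exists x, c' x f)
    (gs : S -> S') (gf : F -> F') (B : {set S}) :
    {in B &, injective gs} -> {in \bigcup_(x in B) c x &, injective gf} ->
    {in B &, forall x y, e' (gs x) (gs y) = e x y} ->
    {in B & \bigcup_(x in B) c x, forall x f, c' (gs x) (gf f) = (f \in c x)} ->
  embeds (generated (slim_set B)) (slim_fat e'_sym e'_irr c'_slim).
Proof.
move=> gsI gfI gse gsf.
pose g (u : generated (slim_set B)) : slim_fat e'_sym e'_irr c'_slim :=
  match val u : h with inl x => inl (gs x) | inr f => inr (gf (val f)) end.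
have inB x (p : (inl x : h) \in generated_set (slim_set B)) : x \in B.
  move: p; rewrite !inE orbF => /imsetP[u]; rewrite inE => uB xu.
  by move: uB; rewrite -(of_slimK u) in xu *; case: xu => ->.
have inF f (p : (inr f : h) \in generated_set (slim_set B)) :
    val f \in \bigcup_(x in B) c x.
  move: p; rewrite !inE => /orP[/imsetP[u _ fu]|/existsP[u]].
    by rewrite -(of_slimK u) in fu.
  rewrite inE -{2}(of_slimK u) => /andP[uB fu].
  by apply/bigcupP; exists (of_slim u).
apply: (@embeds_inj _ _ g) => [[[x|f] p] [[y|f'] q]|[[x|f] p] [[y|f'] q]|[[x|f] p]] //=.
- by case=> /gsI xy; apply: val_inj; congr inl; apply: xy; apply: inB.
- by case=> /gfI xy; apply: val_inj; congr inr; apply: val_inj; apply: xy; apply: inF.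
- by apply: gse; apply: inB.
- by apply: gsf; [apply: inB|apply: inF].
- by apply: gsf; [apply: inB|apply: inF].
Qed.

End SlimFat.

(** * Two-element sets cut by other sets *)

Section TwoSets.
Variable T : finType.
Implicit Types A B D : {set T}.

Lemma card2_split A B f g : #|A| = 2%N -> #|A :&: B| = 1%N ->
  f \in A -> g \in A -> (f \in B) = (g \in B) -> f = g.
Proof.
move=> A2 AB1 fA gA fgB; have := cardsID B A; rewrite A2 AB1 => AD1.
have [fB|fB] := boolP (f \in B).
  have /eqP/cards1P[t /setP E] := AB1.
  have := E f; have := E g; rewrite !inE fA gA -fgB fB /=.
  by move=> /esym/eqP-> /esym/eqP->.
have {}AD1 : #|A :\: B| == 1%N by lia.
have /cards1P[t /setP E] := AD1.
have := E f; have := E g; rewrite !inE fA gA -fgB fB /=.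
by move=> /esym/eqP-> /esym/eqP->.
Qed.

Lemma card2_sub A B D : #|D| = 2%N -> #|A :&: D| = 1%N -> #|B :&: D| = 1%N ->
  A :&: B = set0 -> {in D, forall f, (f \in B) = (f \notin A)}.
Proof.
move=> D2 A1 B1 AB0 f fD; have [fA|fA] := boolP (f \in A).
  apply/negP=> fB; have : f \in A :&: B by rewrite inE fA.
  by rewrite AB0 inE.
have E : D :\: A = B :&: D.
  apply/esym/eqP; rewrite eqEcard; apply/andP; split.
    apply/subsetP=> g; rewrite !inE => /andP[gB ->]; rewrite andbT.
    apply/negP=> gA; have : g \in A :&: B by rewrite inE gA.
    by rewrite AB0 inE.
  by have := cardsID A D; rewrite setIC A1 B1 D2; lia.
by have /setP/(_ f) := E; rewrite !inE fA fD !andbT => /esym.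
Qed.

End TwoSets.

(** * Classes of parallel vectors *)

Section Blocks.
Variables (S F : finType) (e : rel S) (c : S -> {set F}).
Hypotheses (e_sym : symmetric e) (e_irr : irreflexive e).
Implicit Types x y z : S.

Definition sp x y : int := (e x y)%:Z - #|c x :&: c y|%:Z.

(** Gram conditions for S + 3 I, whose diagonal entry is 3 minus the number of fat neighbours:
    vectors are zero or of length one, and [sp_mul] says that being equal or opposite is transitive,
    with signs multiplying. *)
Record admissible : Prop := Admissible {
  card_inc : forall x, #|c x| = 2%N \/ #|c x| = 3%N;
  sp_inc3 : forall x y, #|c x| = 3%N -> x != y -> sp x y = 0;
  sp_bound : forall x y, x != y -> `|sp x y| <= 1;
  sp_mul : forall x y z, x != y -> y != z -> x != z ->
    sp x y != 0 -> sp y z != 0 -> sp x z = sp x y * sp y z }.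

Hypothesis adm : admissible.

Definition linked x y := (x == y) || (sp x y != 0).
Definition block x : {set S} := [set y | linked x y].

Lemma spC x y : sp x y = sp y x.
Proof. by rewrite /sp e_sym setIC. Qed.

Lemma linked_sym : symmetric linked.
Proof. by move=> x y; rewrite /linked eq_sym spC. Qed.

Lemma linked_trans : transitive linked.
Proof.
move=> y x z /predU1P[->|xy] // /predU1P[<-|yz]; first by rewrite /linked xy orbT.
rewrite /linked; have [->|xz] //= := eqVneq x z.
have [E|nxy] := eqVneq x y; first by rewrite E.
have [E|nyz] := eqVneq y z; first by rewrite -E.
by rewrite (sp_mul adm nxy nyz xz xy yz) mulf_neq0.
Qed.

Lemma linked_equiv : equivalence_rel linked.
Proof.
move=> x y z; split=> [|xy]; first by rewrite /linked eqxx.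
apply/idP/idP; last exact: linked_trans.
by apply: linked_trans; rewrite linked_sym.
Qed.

Lemma card_inc2 x y : x != y -> sp x y != 0 -> #|c x| = 2%N.
Proof. by move=> xy; case: (card_inc adm x) => // /sp_inc3 ->. Qed.

Lemma sp_cases x y : x != y -> sp x y != 0 ->
  sp x y = 1 /\ e x y /\ c x :&: c y = set0 \/
  sp x y = -1 /\ (~~ e x y /\ #|c x :&: c y| = 1%N \/ e x y /\ c x = c y).
Proof.
move=> xy s0; have b := sp_bound adm xy.
have cx := card_inc2 xy s0.
have cy : #|c y| = 2%N by apply: (@card_inc2 y x); [rewrite eq_sym|rewrite spC].
have sE : sp x y = (e x y)%:Z - #|c x :&: c y|%:Z by [].
have [s1|s1] : sp x y = 1 \/ sp x y = -1 by lia.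
  left; split=> //; have := sE; case: (e x y); last by lia.
  by rewrite s1 => E; split=> //; apply/eqP; rewrite -cards_eq0; lia.
right; split=> //; have := sE; case: (e x y); last by left; split=> //; lia.
rewrite s1 => E; right; split=> //.
have {}E : #|c x :&: c y| = 2%N by lia.
have Ex : c x :&: c y = c x by apply/eqP; rewrite eqEcard subsetIl E cx.
have Ey : c x :&: c y = c y by apply/eqP; rewrite eqEcard subsetIr E cy.
by rewrite -[LHS]Ex.
Qed.

Lemma embeds_f1 x : #|c x| = 3%N ->
  embeds (generated (slim_set c e_sym e_irr (block x))) f1.
Proof.
move=> c3; have E : block x = [set x].
  apply/setP=> y; rewrite !inE /linked [y == x]eq_sym.
  by have [//|xy] := eqVneq x y; rewrite (sp_inc3 adm c3 xy).
rewrite E; apply: (@embeds_inc _ _ _ _ _ _ _ _ _ _ _ _ _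
  (fun=> tt) (fun f => inord (index f (enum (c x))))); rewrite ?big_set1.
- by move=> y z /set1P-> /set1P->.
- move=> f g fx gx /(congr1 val) /=.
  have lt k : k \in c x -> (index k (enum (c x)) < 3)%N.
    by rewrite -c3 cardE index_mem mem_enum.
  rewrite !inordK ?lt // => fg.
  by rewrite -(nth_index f (_ : f \in enum (c x))) ?fg ?nth_index ?mem_enum.
- by move=> y z /set1P-> /set1P->; rewrite e_irr.
- by move=> y f /set1P-> ->.
Qed.

(** Let z be a third vertex of the block. By [sp_mul], [sp x z] and [sp y z] are opposite, so one of
    them is 1 and [c z] is disjoint from the common set [c x = c y]; the other cannot then be -1. *)
Lemma embeds_f3 x y : x != y -> e x y -> sp x y = -1 -> c x = c y ->
  embeds (generated (slim_set c e_sym e_irr (block x))) f3.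
Proof.
move=> xy exy sxy cxy.
have sxy0 : sp x y != 0 by rewrite sxy.
have cx := card_inc2 xy sxy0.
have E : block x = [set x; y].
  apply/setP=> z; rewrite !inE /linked [z == x]eq_sym [z == y]eq_sym.
  have [//|xz] := eqVneq x z; have [<-//|yz] := eqVneq y z.
  apply/negbTE; rewrite /= negbK; apply: contraT => sxz0.
  have yx : y != x by rewrite eq_sym.
  have syx : sp y x = -1 by rewrite spC.
  have syx0 : sp y x != 0 by rewrite syx.
  have sz := sp_mul adm yx xz yz syx0 sxz0; rewrite syx in sz.
  have disj u v : u != v -> sp u v = 1 -> #|c u :&: c v| = 0%N.
    move=> uv s1; have s0 : sp u v != 0 by rewrite s1.
    by case: (sp_cases uv s0) => [[_ [_ ->]]|[]]; rewrite ?cards0 // s1.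
  case: (sp_cases xz sxz0) => [[s1 _]|[s1 _]]; rewrite s1 in sz.
    by move: sz; rewrite /sp -cxy disj //; case: (e y z).
  by move: s1; rewrite /sp cxy disj //; case: (e x z).
have yx : (y == x) = false by rewrite eq_sym (negPf xy).
have /eqP/cards2P[p [q [pq Ecx]]] := cx.
have qp : (q == p) = false by rewrite eq_sym (negPf pq).
rewrite E; apply: (@embeds_inc _ _ _ _ _ _ _ _ _ _ _ _ _
  (fun z => z == x) (fun f => f == p));
  rewrite ?bigcup_setU ?big_set1 -?cxy ?setUid ?Ecx.
- by move=> u v; rewrite !inE => /orP[]/eqP-> /orP[]/eqP->; rewrite ?eqxx ?yx.
- by move=> u v; rewrite !inE => /orP[]/eqP-> /orP[]/eqP->; rewrite ?eqxx ?qp.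
- by move=> u v; rewrite !inE => /orP[]/eqP-> /orP[]/eqP->;
    rewrite /f3_adj ?eqxx ?yx ?e_irr ?exy // e_sym exy.
- by move=> u f; rewrite !inE => /orP[]/eqP-> fx; rewrite -?cxy Ecx !inE fx.
Qed.

(** * Blocks with a non-adjacent opposite pair *)

Section MixedBlock.
Variables x y : S.
Hypotheses (xy : x != y) (nexy : ~~ e x y) (sxy : sp x y = -1).

(** The sign of the vector of z relative to that of x; x itself counts as plus, because [sp x x] is
    -2 or -3. *)
Definition minus z : bool := sp x z == -1.

Let sxx : sp x x != -1.
Proof. by rewrite /sp e_irr setIid; case: (card_inc adm x) => ->. Qed.

Lemma cardI_base : #|c x :&: c y| = 1%N.
Proof. by move: sxy; rewrite /sp (negPf nexy); lia. Qed.

Lemma block_base : x \in block x /\ y \in block x.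
Proof. by rewrite !inE /linked eqxx sxy orbT. Qed.

Lemma minus_base : minus x = false /\ minus y = true.
Proof. by rewrite /minus (negPf sxx) sxy eqxx. Qed.

Lemma sp_block u v : u \in block x -> v \in block x -> u != v ->
  sp u v = if minus u == minus v then 1 else -1.
Proof.
have sx w : w \in block x -> x != w -> sp x w = if minus w then -1 else 1.
  rewrite inE /linked => /predU1P[->|s0 xw]; first by rewrite eqxx.
  have := sp_bound adm xw; rewrite /minus; case: eqP => //; lia.
move=> ux vx uv; have [mx _] := minus_base.
have [xu|xu] := eqVneq x u.
  by rewrite -xu mx sx // ?xu //; case: minus.
have [xv|xv] := eqVneq x v.
  by rewrite -xv mx spC sx //; case: minus.
have nux : u != x by rewrite eq_sym.
rewrite (sp_mul adm nux xv uv) ?(spC u x) ?(sx u) ?(sx v) //;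
  by case: (minus u); case: (minus v).
Qed.

Lemma card_block u : u \in block x -> #|c u| = 2%N.
Proof.
move=> ux; have [bx by_] := block_base.
have [->|xu] := eqVneq u x.
  by apply: (card_inc2 xy); rewrite sxy.
by apply: (card_inc2 xu); rewrite sp_block //; case: ifP.
Qed.

Lemma same_sign u v : u \in block x -> v \in block x -> u != v ->
  minus u = minus v -> e u v /\ c u :&: c v = set0.
Proof.
move=> ux vx uv muv; have := sp_block ux vx uv; rewrite muv eqxx => s1.
have s0 : sp u v != 0 by rewrite s1.
by case: (sp_cases uv s0) => [[]//|[]]; rewrite s1.
Qed.

(* If c u = c v for u, v of opposite signs, then the mixed pair (x, y), or x
   and v when u <> x, would share a fat neighbour and be disjoint. *)
Lemma opposite_sign u v : u \in block x -> v \in block x ->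
  minus u = false -> minus v = true -> ~~ e u v /\ #|c u :&: c v| = 1%N.
Proof.
move=> ux vx mu mv; have [bx by_] := block_base; have [mx my] := minus_base.
have uv : u != v by apply: contraTneq mv => <-; rewrite mu.
have suv := sp_block ux vx uv; rewrite mu mv /= in suv.
have s0 : sp u v != 0 by rewrite suv.
case: (sp_cases uv s0) => [[]|[_ [//|[_ cuv]]]]; first by rewrite suv.
have [E|xu] := eqVneq x u; last first.
  have [_ D] := same_sign bx ux xu (etrans mx (esym mu)).
  have xv : x != v by apply: contraTneq mv => <-; rewrite mx.
  have := sp_block bx vx xv; rewrite mx mv /sp -cuv D cards0 /=.
  by case: (e x v).
have [E'|yv] := eqVneq y v.
  by rewrite -E -E' nexy cardI_base.
have [_ D] := same_sign by_ vx yv (etrans my (esym mv)).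
by have := cardI_base; rewrite E cuv setIC D cards0.
Qed.

Lemma opposite_cardI u v : u \in block x -> v \in block x ->
  minus u != minus v -> ~~ e u v /\ #|c u :&: c v| = 1%N.
Proof.
move=> ux vx; case mu: (minus u); case mv: (minus v) => // _.
  by rewrite e_sym setIC; apply: opposite_sign.
exact: opposite_sign.
Qed.

Lemma exists_opposite u : exists2 v, v \in block x & minus v != minus u.
Proof.
have [bx by_] := block_base; have [mx my] := minus_base.
by case: (minus u); [exists x; rewrite ?mx | exists y; rewrite ?my].
Qed.

(** The sets of u and w are disjoint, and each takes one element of [c v] when v has the opposite
    sign. A third vertex v of the same sign cannot exist: for o of the opposite sign, [c o] would
    meet three disjoint sets but has two elements. *)
Lemma same_sign_cover u w v f : u \in block x -> w \in block x ->
    v \in block x -> u != w -> minus u = minus w -> f \in c v ->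
  (f \in c w) = (f \notin c u).
Proof.
move=> ux wx vx uw muw fv; have [_ D] := same_sign ux wx uw muw.
have [mvu|mvu] := eqVneq (minus v) (minus u); last first.
  apply: (card2_sub (card_block vx)) fv => //.
    by have [] := opposite_cardI ux vx _; rewrite // eq_sym.
  by have [] := opposite_cardI wx vx _; rewrite // -muw eq_sym.
have [vu|vu] := eqVneq v u.
  rewrite -vu fv; apply/negP=> fw.
  by have := in_set0 f; rewrite -D -vu inE fv fw.
have [<-|vw] := eqVneq v w.
  have [_ D'] := same_sign vx ux vu mvu.
  by rewrite fv; apply/esym/negP=> fu; have := in_set0 f; rewrite -D' inE fv fu.
have [o ox mo] := exists_opposite u.
have [_ Du] := same_sign vx ux vu mvu.
have [_ Dw] := same_sign vx wx vw (etrans mvu muw).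
have uo : minus u != minus o by rewrite eq_sym.
have vo : minus v != minus o by rewrite mvu.
have wo : minus w != minus o by rewrite -muw.
have [_ /eqP/cards1P[g Eg]] := opposite_cardI vx ox vo.
have /setIP[gv go] : g \in c v :&: c o by rewrite Eg inE.
have gw : g \notin c w.
  by apply/negP=> gw; have := in_set0 g; rewrite -Dw inE gv gw.
have gu : g \notin c u.
  by apply/negP=> gu; have := in_set0 g; rewrite -Du inE gv gu.
have [_ u1] := opposite_cardI ux ox uo; have [_ w1] := opposite_cardI wx ox wo.
by have := card2_sub (card_block ox) u1 w1 D go; rewrite (negPf gw) gu.
Qed.

(** x and y represent the two signs; each sign has room for at most one further vertex. *)
Definition base z : S := if minus z then y else x.

Lemma base_block z : base z \in block x /\ minus (base z) = minus z.
Proof.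
have [bx by_] := block_base; have [mx my] := minus_base.
by rewrite /base; case: (minus z).
Qed.

Lemma inc_base z v f : z \in block x -> v \in block x -> f \in c v ->
  (f \in c z) = ((f \notin c (base z)) == (z != base z)).
Proof.
move=> zx vx fv; have [bx bm] := base_block z.
have [<-|zb] := eqVneq z (base z); first by case: (f \in c z).
have bz : base z != z by rewrite eq_sym.
by rewrite (same_sign_cover bx zx vx bz bm fv); case: (f \in _).
Qed.

(** If u and v were distinct and both different from their base, a fat neighbour of v would avoid u,
    hence lie in [c (base u)] by [same_sign_cover], which is disjoint from [c v]. *)
Lemma base_inj u v : u \in block x -> v \in block x -> minus u = minus v ->
  (u != base u) = (v != base v) -> u = v.
Proof.
move=> ux vx muv; rewrite {2}/base -muv -/(base u).
have [E|ub] := eqVneq u (base u); first by case: eqP => // ->.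
move=> /esym vb; apply/eqP; apply: contraT => uv.
have [bx bm] := base_block u; have [_ D] := same_sign ux vx uv muv.
have bv : base u != v by rewrite eq_sym.
have [_ D'] := same_sign bx vx bv (etrans bm muv).
have /card_gt0P[f fv] : (0 < #|c v|)%N by rewrite (card_block vx).
have fu : f \notin c u.
  by apply/negP=> fu; have := in_set0 f; rewrite -D inE fu fv.
have bu : base u != u by rewrite eq_sym.
have := same_sign_cover bx ux vx bu bm fv; rewrite (negPf fu) => /esym/negbFE fb.
by have := in_set0 f; rewrite -D' inE fb fv.
Qed.

Lemma embeds_f2 :
  embeds (generated (slim_set c e_sym e_irr (block x))) f2.
Proof.
have [bx by_] := block_base; have [mx my] := minus_base.
(* Plus vertices become the x_i and minus vertices the y_j, with x and y at index [false]. A fat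
   vertex is indexed by whether it avoids x and whether it avoids y. *)
apply: (@embeds_inc _ _ _ _ _ _ _ _ _ _ _ _ _
  (fun z => (minus z, z != base z)) (fun f => (f \notin c x, f \notin c y))).
- by move=> u v ux vx [muv buv]; apply: base_inj.
- move=> f g /bigcupP[u ux fu] /bigcupP[v vx gv] [/negb_inj fgx /negb_inj fgy].
  have fgb w : (f \in c (base w)) = (g \in c (base w)).
    by rewrite /base; case: (minus w).
  (* Thus f and g lie in the same two-element set [c u], which the base vertex of the opposite sign
     cuts into singletons. *)
  have gu : g \in c u by rewrite (inc_base ux vx gv) -fgb -(inc_base ux ux fu).
  have [mu|mu] := boolP (minus u).
    have [|_ I1] := @opposite_cardI u x ux bx; first by rewrite mu mx.
    exact: card2_split (card_block ux) I1 fu gu fgx.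
  have [|_ I1] := @opposite_cardI u y ux by_; first by rewrite (negPf mu) my.
  exact: card2_split (card_block ux) I1 fu gu fgy.
- move=> u v ux vx; rewrite /f2_adj /=.
  have [<-|uv] := eqVneq u v; first by rewrite e_irr !eqxx.
  have [muv|muv] := eqVneq (minus u) (minus v); last first.
    by have [/negPf->] := opposite_cardI ux vx muv.
  have [-> _] := same_sign ux vx uv muv.
  by apply/eqP=> buv; case/eqP: uv; apply: base_inj.
- move=> z f zx /bigcupP[v vx fv]; rewrite (inc_base zx vx fv) /f2_inc /base /=.
  by case: (minus z).
Qed.

End MixedBlock.
End Blocks.

(** The graph serves as its own extension and is partitioned by [linked], so entries between classes
    vanish. Three fat neighbours give f1; otherwise the opposite vector from the second hypothesis
    decides between f2 and f3. *)
Lemma line_hoffman_inc (S F : finType) (e : rel S) (c : S -> {set F})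
    (e_sym : symmetric e) (e_irr : irreflexive e) :
    admissible e c ->
    (forall x, #|c x| = 2%N -> exists2 y, x != y & sp e c x y = -1) ->
  line_hoffman f123 (inc_hoffman c e_sym e_irr).
Proof.
move=> adm neg; set h := inc_hoffman c e_sym e_irr; exists h; split.
  have hU : hoffman_set [set: h].
    by move=> x _ /fat_slim[y [sy xy]]; exists y; rewrite in_setT.
  exists [set: h], hU; split; first exact: hiso_setT.
  by move=> x _; rewrite in_setT.
pose R := relpre (@of_slim _ _ _ c e_sym e_irr) (linked e c).
have Rsym u v : R u v = R v u by apply: linked_sym.
have Req : {in [set: slim_graph h] & &, equivalence_rel R}.
  by move=> u v w _ _ _; apply: linked_equiv.
exists (equivalence_partition R [set: slim_graph h]); split.
  split; first exact: equivalence_partitionP.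
    move=> _ _ /imsetP[u _ ->] /imsetP[v _ ->] neq x y; rewrite !inE /= => ux vy.
    rewrite special_inc -/(sp e c _ _); apply/eqP; apply: contraNT neq => sxy.
    have xy : R x y by rewrite /R /= /linked sxy orbT.
    have uv : R u v.
      by apply: (linked_trans adm) ux (linked_trans adm xy _); rewrite linked_sym.
    apply/eqP/setP=> w; rewrite !inE /=.
    by have [_ /(_ uv)] := linked_equiv e_sym adm (of_slim u) (of_slim v) (of_slim w).
  by move=> W _; apply: special_generated.
move=> _ /imsetP[u _ ->].
have -> : [set v in [set: slim_graph h] | R u v] =
    slim_set c e_sym e_irr (block e c (of_slim u)).
  by apply/setP=> v; rewrite !inE.
case: (card_inc adm (of_slim u)) => [c2|c3]; last first.
  by exists f1; [exact: Or31|apply: embeds_f1].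
have [y xy sxy] := neg _ c2.
have s0 : sp e c (of_slim u) y != 0 by rewrite sxy.
have [[]|[_ [[nexy _]|[exy cxy]]]] := sp_cases e_sym adm xy s0.
- by rewrite sxy.
- by exists f2; [exact: Or32|apply: embeds_f2 sxy].
- by exists f3; [exact: Or33|apply: embeds_f3 exy sxy cxy].
Qed.

(** * New fat vertices for classes without opposite vectors *)

Section Extension.
Variables (S F : finType) (e : rel S) (c : S -> {set F}).
Hypotheses (e_sym : symmetric e) (e_irr : irreflexive e).
Hypothesis adm : admissible e c.
Implicit Types x y z : S.

(** The case y = x is harmless: for irreflexive [e], [sp e c x x] is -2 when x has two fat
    neighbours. *)
Definition pure x : bool := (#|c x| == 2)%N && [forall y, sp e c x y != -1].

Definition pure_blocks : {set {set S}} := [set block e c x | x in pure].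

(* Each vertex of a pure block has two fat neighbours; sharing a third one
   annihilates the entries 1 of S inside the block. *)
Definition extend x : {set F + {set S}} :=
  [set f | match f with
           | inl f => f \in c x
           | inr A => (A \in pure_blocks) && (x \in A)
           end].

Lemma pure_sp x y : pure x -> x != y -> sp e c x y = (linked e c x y)%:Z.
Proof.
move=> /andP[_ /forallP/(_ y)] s xy; have := sp_bound adm xy.
by rewrite /linked (negPf xy) /=; case: eqP s => [->//|]; lia.
Qed.

(** The entry at x, y is 1, so by [sp_mul] a vector opposite to y would be opposite to x. *)
Lemma pure_linked x y : pure x -> linked e c x y -> pure y.
Proof.
move=> px xy; have [<-//|nxy] := eqVneq x y.
have sxy := pure_sp px nxy; rewrite xy in sxy.
have nyx : y != x by rewrite eq_sym.
have syx0 : sp e c y x != 0 by rewrite spC // sxy.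
apply/andP; split; first by rewrite (card_inc2 adm nyx syx0).
apply/forallP=> z; apply/eqP=> syz.
have [yz|yz] := eqVneq y z; first by rewrite -yz /sp e_irr setIid in syz;
  move: syz; rewrite (card_inc2 adm nyx syx0).
have [xz|xz] := eqVneq x z; first by rewrite -xz spC // sxy in syz.
have := andP px => -[_ /forallP/(_ z)].
by rewrite (sp_mul adm nxy yz xz) ?sxy ?syz.
Qed.

(** Blocks are equivalence classes, so x and y share at most one new fat vertex. *)
Lemma pure_blockP x y A :
  [&& A \in pure_blocks, x \in A & y \in A] =
  (pure x && linked e c x y) && (A == block e c x).
Proof.
apply/and3P/andP=> [[/imsetP[z pz ->]]|[/andP[px xy] /eqP->]]; last first.
  rewrite !inE xy /linked eqxx; split=> //; exact: imset_f.
rewrite !inE => zx zy; have eqR := linked_equiv e_sym adm z x.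
have -> : pure x by apply: pure_linked zx.
split; first by have [_ /(_ zx) <-] := eqR y.
apply/eqP/setP=> w; rewrite !inE; by have [_ /(_ zx) ->] := eqR w.
Qed.

Lemma card_extendI x y : #|extend x :&: extend y| =
  (#|c x :&: c y| + (pure x && linked e c x y))%N.
Proof.
rewrite -!sum1_card big_mkcond big_sumType /=; congr (_ + _)%N.
  by rewrite [RHS]big_mkcond; apply: eq_bigr => f _; rewrite !inE.
rewrite (eq_bigr (fun A => if pure x && linked e c x y && (A == block e c x)
  then 1 else 0)%N); last first.
  by move=> A _; rewrite -pure_blockP !inE; case: (A \in _).
rewrite -big_mkcond; case: (_ && _) => /=; last by rewrite big_pred0.
by rewrite (big_pred1 (block e c x)).
Qed.

Lemma card_extend x : #|extend x| = (#|c x| + pure x)%N.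
Proof. by rewrite -(setIid (extend x)) card_extendI setIid /linked eqxx andbT. Qed.

Lemma sp_extend x y :
  sp e extend x y = sp e c x y - (pure x && linked e c x y)%:Z.
Proof. by rewrite /sp card_extendI PoszD opprD addrA. Qed.

Lemma sp_extend_pure x y : pure x -> x != y -> sp e extend x y = 0.
Proof. by move=> px xy; rewrite sp_extend (pure_sp px xy) px subrr. Qed.

Lemma sp_extend_npure x y : ~~ pure x -> sp e extend x y = sp e c x y.
Proof. by move=> /negPf px; rewrite sp_extend px subr0. Qed.

(** Pure vertices become zero vectors with three fat neighbours; the rows of the other vertices keep
    their entries. *)
Lemma admissible_extend : admissible e extend.
Proof.
split=> [x|x y c3 xy|x y xy|x y z xy yz xz].
- rewrite card_extend; have [/andP[/eqP-> _]|_] := boolP (pure x); first by right.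
  by rewrite addn0; apply: (card_inc adm).
- have [px|px] := boolP (pure x); first exact: sp_extend_pure.
  rewrite sp_extend_npure // (sp_inc3 adm) //.
  by move: c3; rewrite card_extend (negPf px) addn0.
- have [px|px] := boolP (pure x); first by rewrite sp_extend_pure.
  by rewrite sp_extend_npure // (sp_bound adm).
- have [px|px] := boolP (pure x); first by rewrite sp_extend_pure ?eqxx.
  have [py|py] := boolP (pure y); first by rewrite (sp_extend_pure py) ?eqxx.
  by rewrite !sp_extend_npure //; apply: (sp_mul adm).
Qed.

Lemma extend_neg x : #|extend x| = 2%N ->
  exists2 y, x != y & sp e extend x y = -1.
Proof.
rewrite card_extend; have [/andP[/eqP-> _] //|px] := boolP (pure x).
rewrite addn0 => c2; have := px; rewrite negb_and c2 eqxx /= negb_forall.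
case/existsP=> y; rewrite negbK => /eqP sxy; exists y; rewrite ?sp_extend_npure //.
by apply/eqP=> E; move: sxy; rewrite -E /sp e_irr setIid c2.
Qed.

End Extension.

(** Test vectors with coefficients 0, 1 and -1 suffice. On two vertices they bound the integer
    entries by 1 and kill the row of a zero vector; on three, if s and t are 1 or -1, a suitable
    choice of signs forces the third entry to be s t. *)
Lemma admissible_fats (G : sgraph) (N : nat) :
    (forall u : G -> int, 0 <= bform u u) -> (54 * (9 * 81) < N)%N ->
    (forall x : G, (2 <= #|fats_at N x|)%N) ->
  admissible (@adj G) (fats_at N).
Proof.
move=> psd N_large ge2.
have le3 x := card_fats_at psd N_large x.
have psdM := gram_at_psd psd N_large.
have Mxx x : gram_at N x x = 3 - #|fats_at N x|%:Z.
  by rewrite /gram_at /special_at adj_irr setIid eqxx; lia.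
have Mxy (x y : G) : x != y -> gram_at N x y = sp (@adj G) (fats_at N) x y.
  by move=> /negPf xy; rewrite /gram_at xy /special_at /sp addr0.
have psd2 x y (a : int) : x != y -> `|a| <= 1 ->
    0 <= a * a * (3 - #|fats_at N x|%:Z) + (3 - #|fats_at N y|%:Z)
         + 2 * (a * sp (@adj G) (fats_at N) x y).
  move=> xy a1; have := @psdM x y y a 1 0 a1 isT isT.
  by rewrite !Mxx Mxy //; lia.
have fat2 x y : x != y -> sp (@adj G) (fats_at N) x y != 0 ->
    #|fats_at N x| = 2%N.
  move=> xy s0; have := psd2 x y 1 xy isT; have := psd2 x y (-1) xy isT.
  by have := le3 x; have := ge2 x; have := ge2 y; lia.
split=> [x|x y c3 xy|x y xy|x y z xy yz xz sxy syz].
- by have := le3 x; have := ge2 x; lia.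
- apply/eqP; apply: contraT => /(fat2 _ _ xy); lia.
- have := psd2 x y 1 xy isT; have := psd2 x y (-1) xy isT.
  by have := ge2 x; have := ge2 y; lia.
have yx : y != x by rewrite eq_sym.
have cx := fat2 x y xy sxy; have cy := fat2 y z yz syz.
have bnd u v : u != v -> `|sp (@adj G) (fats_at N) u v| <= 1.
  move=> uv; have := psd2 u v 1 uv isT; have := psd2 u v (-1) uv isT.
  by have := ge2 u; have := ge2 v; lia.
have cz := ge2 z.
have sgn (a b c : int) : `|a| <= 1 -> `|b| <= 1 -> `|c| <= 1 ->
    0 <= a * a + b * b + c * c + 2 * (a * b * sp (@adj G) (fats_at N) x y
      + a * c * sp (@adj G) (fats_at N) x z + b * c * sp (@adj G) (fats_at N) y z).
  move=> a1 b1 c1; have := @psdM x y z a b c a1 b1 c1.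
  rewrite !Mxx !Mxy // cx cy => H; apply: (le_trans H); nia.
have := bnd x y xy; have := bnd y z yz; have := bnd x z xz.
have := sgn 1 1 1 isT isT isT; have := sgn 1 1 (-1) isT isT isT.
have := sgn 1 (-1) 1 isT isT isT; have := sgn (-1) 1 1 isT isT isT.
move: sxy syz; set s := sp _ _ x y; set t := sp _ _ y z; set r := sp _ _ x z.
move=> s0 t0 h1 h2 h3 h4 r1 t1 s1.
have Es : s = 1 \/ s = -1 by lia.
have Et : t = 1 \/ t = -1 by lia.
by case: Es Et => [Es|Es] [Et|Et]; rewrite Es Et; lia.
Qed.

Theorem theorem1p4 (R : realType) :
  exists K : nat, (0 < K)%N /\
    forall G : sgraph,
      (forall x : G, (K < deg x)%N) ->
      (forall (x : G) (P : {set G}),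
         plex 5 P -> x \in P -> (#|P| <= deg x - K)%N) ->
      -3 <= lambda_min G R ->
      exists h : hoffman,
        [/\ tfat h 2, line_hoffman f123 h & giso G (slim_graph h)].
Proof.
have [N N_large] : exists N, (54 * (9 * 81) < N)%N.
  by exists (54 * (9 * 81)).+1.
(* K is the Ramsey bound for a clique of size N against ten independent vertices. *)
exists (2 ^ (N + 10))%N; split=> [|G degG plexG lmin]; first by rewrite expn_gt0.
have psd (u : G -> int) := bform_ge0 u lmin.
have adm : admissible (@adj G) (fats_at N).
  apply: admissible_fats => // x; apply: card_fats_at_ge2 => // P plexP xP.
  exact: plexG.
have esym := @adj_sym G; have eirr := @adj_irr G.
exists (inc_hoffman (extend (@adj G) (fats_at N)) esym eirr); split.
- apply: tfat_inc => x.
  by case: (card_inc (admissible_extend esym eirr adm) x) => ->.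
- apply: line_hoffman_inc; first exact: admissible_extend.
  exact: extend_neg.
- exact: (giso_inc (extend (@adj G) (fats_at N)) esym eirr).
Qed.
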